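(* Fix $\kappa_{max}>0$ and consider trajectories $\gamma:[0,T]\to\mathbb{R}^2$ with continuous second derivatives whose curvature is bounded by $\kappa_{max}$. Then: (i) for $r>0$, the square count $C_{S_r}$ is an unstable count; (ii) if $r<\frac{1}{\kappa_{max}}$, the disk count $C_{B_r}$ is stable; (iii) if $r_1<r_2<\frac{1}{\kappa_{max}}$, the robust local square count $C_{S_{r_1},S_{r_2}}$ is stable (to perturbations of a trajectory).
   Context: For $r>0$ and $x=(x_1,x_2)\in\mathbb{R}^2$ let $B_r(x)$ be the closed Euclidean disk of radius $r$ about $x$ and $S_r(x)=\{y:\max(|y_1-x_1|,|y_2-x_2|)\le r\}$ the closed square. For a trajectory $\gamma:[0,T]\to\mathbb{R}^2$ and a set $K\subset\mathbb{R}^2$, let $A_K$ be the set of intervals $[a,b]\subset[0,T]$ with $\gamma([a,b])\subset K$ that are maximal with this property (no strictly larger subinterval of $[0,T]$ containing $[a,b]$ has trace in $K$). Define $C_{B_r}(x)=|A_{B_r(x)}|$ and $C_{S_r}(x)=|A_{S_r(x)}|$. For $r_1<r_2$, intervals $[a_1,b_1],[a_2,b_2]\in A_{S_{r_1}(x)}$ are equivalent if some $[a,b]\in A_{S_{r_2}(x)}$ satisfies $[a_1,b_1]\cup[a_2,b_2]\subset[a,b]$; $C_{S_{r_1},S_{r_2}}(x)$ is the number of equivalence classes of $A_{S_{r_1}(x)}$ under this relation. An $\epsilon$-perturbation of a trajectory $\gamma$ with curvature bounded by $\kappa_{max}$ is a trajectory $\hat\gamma$ on the same time domain, with the same curvature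 bound, such that $\|\hat\gamma(t)-\gamma(t)\|_2\le\epsilon$ for all $t$; it is small if $\epsilon<\frac{1}{\kappa_{max}}$. A count function $C$ (assigning to each trajectory a function $\mathbb{R}^2\to\mathbb{N}$) is stable if for every trajectory $\gamma$ with curvature bounded by $\kappa_{max}$ the change in its value due to any small $\epsilon$-perturbation is bounded everywhere, i.e. there is a bound $M(\gamma)$ (which may depend on $\gamma$) such that $|C[\hat\gamma](x)-C[\gamma](x)|\le M(\gamma)$ for all small $\epsilon$-perturbations $\hat\gamma$ of $\gamma$ and all $x\in\mathbb{R}^2$; otherwise it is unstable. *)

(* Defs.v *)
From Stdlib Require Import Reals List ClassicalEpsilon.
From Coquelicot Require Import Coquelicot.
Open Scope R_scope.

Record traj := mkTraj { T : R; gx : R -> R; gy : R -> R }.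

(* f is C^2 on [0,T]: twice differentiable with continuous second derivative
   on an open neighbourhood of [a,b] (equivalent, for the values on [a,b],
   to C^2 on the closed interval, since such functions extend). *)
Definition C2_on (f : R -> R) (a b : R) : Prop :=
  exists d, 0 < d /\ forall t, a - d < t < b + d ->
    ex_derive f t /\ ex_derive (Derive f) t /\
    continuous (Derive (Derive f)) t.

Definition speed2 (g : traj) (t : R) : R :=
  (Derive (gx g) t) ^ 2 + (Derive (gy g) t) ^ 2.

Definition curvature (g : traj) (t : R) : R :=
  Rabs (Derive (gx g) t * Derive (Derive (gy g)) t
        - Derive (gy g) t * Derive (Derive (gx g)) t)
  / (speed2 g t * sqrt (speed2 g t)).

Definition is_traj (kmax : R) (g : traj) : Prop :=
  0 < T g /\ C2_on (gx g) 0 (T g) /\ C2_on (gy g) 0 (T g) /\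
  (forall t, 0 <= t <= T g -> 0 < speed2 g t) /\
  (forall t, 0 <= t <= T g -> curvature g t <= kmax).

Definition small_perturbation (kmax : R) (g gh : traj) : Prop :=
  is_traj kmax gh /\ T gh = T g /\
  exists eps, eps < / kmax /\
    forall t, 0 <= t <= T g ->
      sqrt ((gx gh t - gx g t) ^ 2 + (gy gh t - gy g t) ^ 2) <= eps.

Definition point := (R * R)%type.

Definition disk (c : point) (r : R) (p : point) : Prop :=
  (fst p - fst c) ^ 2 + (snd p - snd c) ^ 2 <= r ^ 2.

Definition square (c : point) (r : R) (p : point) : Prop :=
  Rmax (Rabs (fst p - fst c)) (Rabs (snd p - snd c)) <= r.

Definition inside (g : traj) (K : point -> Prop) (a b : R) : Prop :=
  forall t, a <= t <= b -> K (gx g t, gy g t).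

Definition A_set (g : traj) (K : point -> Prop) (i : R * R) : Prop :=
  0 <= fst i /\ fst i <= snd i /\ snd i <= T g /\ inside g K (fst i) (snd i) /\
  forall a' b', 0 <= a' -> a' <= fst i -> snd i <= b' -> b' <= T g ->
    inside g K a' b' -> a' = fst i /\ b' = snd i.

(* Cardinality of a set, with None standing for "infinite". *)
Definition card_is {X : Type} (A : X -> Prop) (n : nat) : Prop :=
  exists l : list X, NoDup l /\ length l = n /\ forall x, A x <-> In x l.

Definition ecard {X : Type} (A : X -> Prop) : option nat :=
  match excluded_middle_informative (exists n, card_is A n) with
  | left H => Some (proj1_sig (constructive_indefinite_description _ H))
  | right _ => None
  end.

Definition count_fun := traj -> point -> option nat.

Definition C_B (r : R) : count_fun := fun g x => ecard (A_set g (disk x r)).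
Definition C_S (r : R) : count_fun := fun g x => ecard (A_set g (square x r)).

Definition robust_equiv (g : traj) (x : point) (r2 : R) (i j : R * R) : Prop :=
  exists k, A_set g (square x r2) k /\
    fst k <= fst i /\ snd i <= snd k /\ fst k <= fst j /\ snd j <= snd k.

Definition robust_classes (g : traj) (x : point) (r1 r2 : R)
    (P : R * R -> Prop) : Prop :=
  exists i, A_set g (square x r1) i /\
    P = (fun j => A_set g (square x r1) j /\ robust_equiv g x r2 i j).

Definition C_SS (r1 r2 : R) : count_fun :=
  fun g x => ecard (robust_classes g x r1 r2).

(* |u - v| <= M in the extended naturals (infinity - infinity counted as 0,
   a finite/infinite change counted as unbounded). *)
Definition ebound (M : nat) (u v : option nat) : Prop :=
  match u, v with
  | Some n, Some m => (n - m <= M)%nat /\ (m - n <= M)%nat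
  | None, None => True
  | _, _ => False
  end.

Definition stable (kmax : R) (C : count_fun) : Prop :=
  forall g, is_traj kmax g ->
    exists M : nat, forall gh, small_perturbation kmax g gh ->
      forall x, ebound M (C gh x) (C g x).

(* Main.v *)
Require Import Defs.
From Stdlib Require Import Reals.
From Coquelicot Require Import Coquelicot.
From Stdlib Require Import ZArith List FinFun Lra Lia.
From Stdlib Require Import Classical ClassicalEpsilon.
From Stdlib Require Import FunctionalExtensionality PropExtensionality.
Open Scope R_scope.

(** Write [rho = / kmax]. Stability of the disk count and of the robust square count
    follows from one fact: all small perturbations [h] of a trajectory [k] have length
    bounded by a constant depending on [k] only. Indeed two consecutive visits counted
    by [C_B] (resp. [C_SS]) are separated by a path of length at least [2 (rho - r)]
    (resp. [2 (r2 - r1)]).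

    For the length bound cut [[0, T k]] into finitely many windows on which [k] moves by
    at most [rho / 4] and monotonically in some direction [e]. Let [u] be the unit tangent
    of [h]. Up to the small drift of [k], the quantity [(h - k) . u] is nondecreasing and
    bounded by [rho]; it fails to increase substantially along a piece of length
    [4 pi rho] only if [h] circles around [k] in a fixed sense, making at least one and a
    half turns. One of its half turns then has [- e] as its middle direction; the centre of the
    osculating circle of radius [rho] moves backwards during it while [k] moves forwards,
    which is impossible for [h] strictly [rho]-close to [k].

    Instability of the square count: a curve with arbitrarily many bumps of
    small amplitude touches the top edge of a square once per bump. *)

(** * Real functions *)

Lemma is_derive_continuity_pt (f : R -> R) (x l : R) :
  is_derive f x l -> continuity_pt f x.
Proof.
  intros H. apply continuity_pt_filterlim.
  apply (ex_derive_continuous f x). now exists l.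
Qed.

(** [Q] carries whatever is known of the derivative, so one version serves nonnegative, positive and
    vanishing derivatives. *)
Lemma mean_value (f : R -> R) (Q : R -> Prop) (a b : R) : a < b ->
  (forall t, a <= t <= b -> exists l, is_derive f t l /\ Q l) ->
  exists c l, a < c < b /\ is_derive f c l /\ Q l /\ f b - f a = l * (b - a).
Proof.
  intros Hab Hf.
  assert (Hd : forall t, a <= t <= b -> is_derive f t (Derive f t) /\ Q (Derive f t)).
  { intros t Ht. destruct (Hf t Ht) as [l [Hl HQ]].
    now rewrite (is_derive_unique _ _ _ Hl). }
  destruct (MVT_cor2 f (Derive f) a b Hab) as [c [Heq Hc]].
  - intros c Hc. apply is_derive_Reals, Hd, Hc.
  - exists c, (Derive f c). repeat split; try lra; apply Hd; lra.
Qed.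

Lemma derive_nonneg_le (f : R -> R) (a b : R) : a <= b ->
  (forall t, a <= t <= b -> exists l, is_derive f t l /\ 0 <= l) -> f a <= f b.
Proof.
  intros [Hab | ->] Hf; [|lra].
  destruct (mean_value f (Rle 0) a b Hab Hf) as [c [l [_ [_ [Hl E]]]]]. nra.
Qed.

Lemma derive_pos_lt (f : R -> R) (a b : R) : a < b ->
  (forall t, a <= t <= b -> exists l, is_derive f t l /\ 0 < l) -> f a < f b.
Proof.
  intros Hab Hf.
  destruct (mean_value f (Rlt 0) a b Hab Hf) as [c [l [_ [_ [Hl E]]]]]. nra.
Qed.

(** Openness of the complement of [P] at one point; required wherever [P] fails, it is the form of
    closedness used below. *)
Definition locally_false (P : R -> Prop) (t : R) : Prop :=
  exists e, 0 < e /\ forall s, Rabs (s - t) < e -> ~ P s.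

(** Take the supremum of the points where [P] holds: were [P] false there, it would be false just
    below as well, giving a smaller upper bound. *)
Lemma closed_has_last (P : R -> Prop) (c d : R) : c <= d -> P c ->
  (forall t, c <= t <= d -> ~ P t -> locally_false P t) ->
  exists s, c <= s <= d /\ P s /\ forall t, s < t <= d -> ~ P t.
Proof.
  intros Hcd Pc Hcl.
  destruct (completeness (fun t => c <= t <= d /\ P t)) as [s [Hub Hlub]].
  - exists d. intros t [Ht _]. lra.
  - exists c. split; [lra | exact Pc].
  - assert (c <= s) by (apply Hub; split; [lra | exact Pc]).
    assert (s <= d) by (apply Hlub; intros t [Ht _]; lra).
    exists s. split; [lra|]. split.
    + apply NNPP. intros Hn. destruct (Hcl s) as [e [He Hf]]; [lra | exact Hn |].
      assert (s <= s - e); [|lra]. apply Hlub. intros t [Ht Pt].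
      assert (t <= s) by (apply Hub; split; [lra | exact Pt]).
      apply Rnot_lt_le. intros Hlt. apply (Hf t); [|exact Pt].
      apply Rabs_def1; lra.
    + intros t Ht Pt. assert (t <= s) by (apply Hub; split; [lra | exact Pt]). lra.
Qed.

Lemma closed_has_first (P : R -> Prop) (c d : R) : c <= d -> P d ->
  (forall t, c <= t <= d -> ~ P t -> locally_false P t) ->
  exists s, c <= s <= d /\ P s /\ forall t, c <= t < s -> ~ P t.
Proof.
  intros Hcd Pd Hcl.
  destruct (closed_has_last (fun t => P (- t)) (- d) (- c)) as [s [Hs [Ps Hl]]].
  - lra.
  - now rewrite Ropp_involutive.
  - intros t Ht Hn. destruct (Hcl (- t)) as [e [He Hf]]; [lra | exact Hn |].
    exists e. split; [exact He|]. intros u Hu. apply Hf.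
    replace (- u - - t) with (- (u - t)) by ring. now rewrite Rabs_Ropp.
  - exists (- s). split; [lra|]. split; [exact Ps|].
    intros t Ht Pt. apply (Hl (- t)); [lra | now rewrite Ropp_involutive].
Qed.

Lemma locally_false_le (f : R -> R) (A t : R) :
  continuity_pt f t -> ~ f t <= A -> locally_false (fun s => f s <= A) t.
Proof.
  intros Hc Hn. destruct (Hc (f t - A)) as [e [He H]]; [lra|].
  exists e. split; [exact He|]. intros s Hs Hle.
  destruct (Req_dec s t) as [->|Hne]; [lra|].
  assert (Hd : R_dist (f s) (f t) < f t - A).
  { apply H. split; [split; [exact I | congruence] | exact Hs]. }
  unfold R_dist in Hd. apply Rabs_def2 in Hd. lra.
Qed.

(** Take the last time at which [f] is at most [A], then the first later time at which it reaches
    [B]. Later this isolates a half turn of the tangent angle. *)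
Lemma continuous_crossing (f : R -> R) (A B c d : R) : c <= d -> A <= B ->
  (forall t, c <= t <= d -> continuity_pt f t) -> f c <= A -> B <= f d ->
  exists s t, c <= s <= t /\ t <= d /\ f s = A /\ f t = B /\
    forall u, s <= u <= t -> A <= f u <= B.
Proof.
  intros Hcd HAB Hf HA HB.
  assert (Hlast : forall c d A, c <= d -> (forall t, c <= t <= d -> continuity_pt f t) ->
    f c <= A -> A <= f d ->
    exists s, c <= s <= d /\ f s = A /\ forall t, s <= t <= d -> A <= f t).
  { clear. intros c d A Hcd Hf HA HB.
    destruct (closed_has_last (fun s => f s <= A) c d) as [s [Hs [Hle Hgt]]]; auto.
    { intros t Ht. apply locally_false_le, Hf; lra. }
    assert (Heq : f s = A).
    { destruct (Req_dec s d) as [->|]; [lra|].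
      destruct (Rle_lt_or_eq_dec _ _ Hle) as [Hlt|]; [exfalso|assumption].
      destruct (Hf s) with (eps := A - f s) as [e [He Hnear]]; [lra|lra|].
      (* A point just to the right of [s], still below [A] by continuity, contradicts the choice of
         [s]. *)
      set (t := s + Rmin (e / 2) (d - s)).
      assert (0 < Rmin (e / 2) (d - s)) by (apply Rmin_pos; lra).
      assert (Rmin (e / 2) (d - s) <= e / 2) by apply Rmin_l.
      assert (Rmin (e / 2) (d - s) <= d - s) by apply Rmin_r.
      apply (Hgt t); [unfold t; lra|].
      assert (Hd : R_dist (f t) (f s) < A - f s).
      { apply Hnear. split; [split; [exact I|unfold t; lra]|].
        simpl. unfold R_dist, t. apply Rabs_def1; lra. }
      unfold R_dist in Hd. apply Rabs_def2 in Hd. lra. }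
    exists s. repeat split; try lra. intros t Ht.
    destruct (Req_dec t s) as [->|]; [lra|].
    apply Rlt_le, Rnot_le_lt, Hgt; lra. }
  destruct (Hlast c d A) as [s [Hs [Hsa Hge]]]; auto; try lra.
  destruct (closed_has_first (fun t => - f t <= - B) s d) as [t [Ht [Htb Hlt]]];
    [lra|lra| |].
  { intros t Ht. apply (locally_false_le (fun t => - f t)).
    apply (continuity_pt_opp f), Hf; lra. }
  assert (f t = B).
  { destruct (Hlast s t B) as [v [Hv [Hvb _]]]; try lra.
    { intros; apply Hf; lra. }
    destruct (Req_dec v t) as [->|]; [exact Hvb|].
    exfalso. apply (Hlt v); lra. }
  exists s, t. repeat split; try lra.
  - apply Hge; lra.
  - destruct (Req_dec u t) as [->|]; [lra|].
    apply Rnot_lt_le. intros Hbu. apply (Hlt u); lra.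
Qed.

Lemma ivt_le (f : R -> R) (A c d : R) : c <= d ->
  (forall t, c <= t <= d -> continuity_pt f t) -> f c <= A <= f d ->
  exists s, c <= s <= d /\ f s = A.
Proof.
  intros Hcd Hf HA.
  destruct (continuous_crossing f A A c d) as [s [t [Hs [Ht [Hsa _]]]]];
    auto; try lra.
  exists s. split; [lra | exact Hsa].
Qed.

Lemma unit_vector_angle (x y : R) : x ^ 2 + y ^ 2 = 1 ->
  exists a, x = cos a /\ y = sin a.
Proof.
  intros H. assert (Hx : -1 <= x <= 1) by (split; nra).
  assert (Hs : sin (acos x) ^ 2 = y ^ 2).
  { pose proof (sin2_cos2 (acos x)) as E. rewrite cos_acos in E by lra.
    unfold Rsqr in E. nra. }
  assert (Hc : (y - sin (acos x)) * (y + sin (acos x)) = 0) by nra.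
  apply Rmult_integral in Hc as [Hc|Hc].
  - exists (acos x). rewrite cos_acos by lra. split; lra.
  - exists (- acos x). rewrite cos_neg, sin_neg, cos_acos by lra. split; lra.
Qed.

(** * Tangent angle and drift *)

(* [len] is the arc length, [th] the tangent angle, [w] its rate of change. *)
Record polar (rho : R) (hx hy sg th w len : R -> R) (a b : R) : Prop := {
  polar_x : forall t, a <= t <= b -> is_derive hx t (sg t * cos (th t));
  polar_y : forall t, a <= t <= b -> is_derive hy t (sg t * sin (th t));
  polar_th : forall t, a <= t <= b -> is_derive th t (w t);
  polar_len : forall t, a <= t <= b -> is_derive len t (sg t);
  polar_speed : forall t, a <= t <= b -> 0 < sg t;
  polar_curv : forall t, a <= t <= b -> Rabs (w t) * rho <= sg t }.

(** [k] is the reference curve with velocity [(vx, vy)]; [eta] is the angle of a direction [e] in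
    which it never moves backwards. *)
Record window (rho V eta : R) (hx hy kx ky vx vy : R -> R) (a b : R) : Prop := {
  window_x : forall t, a <= t <= b -> is_derive kx t (vx t);
  window_y : forall t, a <= t <= b -> is_derive ky t (vy t);
  window_speed : forall t, a <= t <= b -> vx t ^ 2 + vy t ^ 2 <= V ^ 2;
  window_fwd : forall t, a <= t <= b -> 0 <= vx t * cos eta + vy t * sin eta;
  window_close : forall t, a <= t <= b ->
    (hx t - kx t) ^ 2 + (hy t - ky t) ^ 2 < rho ^ 2 }.

Lemma polar_sub rho hx hy sg th w len a b c d : a <= c -> d <= b ->
  polar rho hx hy sg th w len a b -> polar rho hx hy sg th w len c d.
Proof.
  intros Hc Hd [H1 H2 H3 H4 H5 H6].
  split; intros t Ht; [apply H1|apply H2|apply H3|apply H4|apply H5|apply H6]; lra.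
Qed.

Lemma window_sub rho V eta hx hy kx ky vx vy a b c d : a <= c -> d <= b ->
  window rho V eta hx hy kx ky vx vy a b -> window rho V eta hx hy kx ky vx vy c d.
Proof.
  intros Hc Hd [H1 H2 H3 H4 H5].
  split; intros t Ht; [apply H1|apply H2|apply H3|apply H4|apply H5]; lra.
Qed.

(** Reflection in the horizontal axis exchanges left and right turns, so only one sign of the normal
    component has to be treated. *)
Lemma polar_mirror rho hx hy sg th w len a b : polar rho hx hy sg th w len a b ->
  polar rho hx (fun t => - hy t) sg (fun t => - th t) (fun t => - w t) len a b.
Proof.
  intros [Hx Hy Ht Hl Hs Hc]. split; intros t Hab; auto.
  - rewrite cos_neg. auto.
  - rewrite sin_neg. replace (sg t * - sin (th t)) with (- (sg t * sin (th t))) by ring.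
    apply (is_derive_opp hy), Hy, Hab.
  - apply (is_derive_opp th), Ht, Hab.
  - rewrite Rabs_Ropp. auto.
Qed.

Lemma window_mirror rho V eta hx hy kx ky vx vy a b :
  window rho V eta hx hy kx ky vx vy a b ->
  window rho V (- eta) hx (fun t => - hy t) kx (fun t => - ky t) vx (fun t => - vy t) a b.
Proof.
  intros [Hx Hy Hs Hf Hc]. split; intros t Hab; auto.
  - apply (is_derive_opp ky), Hy, Hab.
  - specialize (Hs t Hab). simpl in *; lra.
  - specialize (Hf t Hab). rewrite cos_neg, sin_neg. lra.
  - specialize (Hc t Hab). simpl in *; lra.
Qed.

(* Components of [h - k] along the unit tangent of [h] and its left normal. *)
Definition tang (hx hy kx ky th : R -> R) (t : R) : R :=
  (hx t - kx t) * cos (th t) + (hy t - ky t) * sin (th t).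
Definition nrml (hx hy kx ky th : R -> R) (t : R) : R :=
  - (hx t - kx t) * sin (th t) + (hy t - ky t) * cos (th t).

Lemma is_derive_tang hx hy kx ky th t hx' hy' kx' ky' w :
  is_derive hx t hx' -> is_derive hy t hy' -> is_derive kx t kx' ->
  is_derive ky t ky' -> is_derive th t w ->
  is_derive (tang hx hy kx ky th) t
    ((hx' - kx') * cos (th t) + (hy' - ky') * sin (th t) + w * nrml hx hy kx ky th t).
Proof.
  intros H1 H2 H3 H4 H5. unfold tang, nrml.
  auto_derive; [repeat split; eexists; eassumption|].
  rewrite (is_derive_unique (fun x : R => hx x) t _ H1), (is_derive_unique (fun x : R => hy x) t _ H2),
    (is_derive_unique (fun x : R => kx x) t _ H3), (is_derive_unique (fun x : R => ky x) t _ H4),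
    (is_derive_unique (fun x : R => th x) t _ H5). ring.
Qed.

Lemma is_derive_nrml hx hy kx ky th t hx' hy' kx' ky' w :
  is_derive hx t hx' -> is_derive hy t hy' -> is_derive kx t kx' ->
  is_derive ky t ky' -> is_derive th t w ->
  is_derive (nrml hx hy kx ky th) t
    (- (hx' - kx') * sin (th t) + (hy' - ky') * cos (th t) - w * tang hx hy kx ky th t).
Proof.
  intros H1 H2 H3 H4 H5. unfold tang, nrml.
  auto_derive; [repeat split; eexists; eassumption|].
  rewrite (is_derive_unique (fun x : R => hx x) t _ H1), (is_derive_unique (fun x : R => hy x) t _ H2),
    (is_derive_unique (fun x : R => kx x) t _ H3), (is_derive_unique (fun x : R => ky x) t _ H4),
    (is_derive_unique (fun x : R => th x) t _ H5). ring.
Qed.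

Lemma tang_nrml_sqr hx hy kx ky th t :
  tang hx hy kx ky th t ^ 2 + nrml hx hy kx ky th t ^ 2 =
  (hx t - kx t) ^ 2 + (hy t - ky t) ^ 2.
Proof.
  unfold tang, nrml. pose proof (sin2_cos2 (th t)) as E. unfold Rsqr in E.
  set (c := cos (th t)) in *. set (s := sin (th t)) in *.
  set (x := hx t - kx t). set (y := hy t - ky t).
  replace (x ^ 2 + y ^ 2) with ((x ^ 2 + y ^ 2) * (s * s + c * c)) by (rewrite E; ring).
  ring.
Qed.

Lemma dot_unit_bound (x y V a : R) : 0 <= V -> x ^ 2 + y ^ 2 <= V ^ 2 ->
  Rabs (x * cos a + y * sin a) <= V.
Proof.
  intros HV H. pose proof (sin2_cos2 a) as E. unfold Rsqr in E.
  apply Rabs_le.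
  assert ((x * cos a + y * sin a) ^ 2 <= V ^ 2).
  { assert ((x * cos a + y * sin a) ^ 2 + (x * sin a - y * cos a) ^ 2 = x ^ 2 + y ^ 2).
    { replace (x ^ 2 + y ^ 2) with ((x ^ 2 + y ^ 2) * (sin a * sin a + cos a * cos a)) by (rewrite E; ring). ring. }
    pose proof (pow2_ge_0 (x * sin a - y * cos a)). lra. }
  split; nra.
Qed.

(** In the derivative of the tangential component [h] contributes its full speed and [k] at least
    [- V], which the term [V * s] absorbs; the rotation of the frame adds [w * nrml]. *)
Lemma tang_drift rho V eta hx hy kx ky vx vy sg th w len a b :
  0 < rho -> 0 <= V -> a <= b ->
  polar rho hx hy sg th w len a b -> window rho V eta hx hy kx ky vx vy a b ->
  forall t, a <= t <= b ->
  exists l, is_derive (fun s => tang hx hy kx ky th s + V * s) t l /\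
    sg t + w t * nrml hx hy kx ky th t <= l.
Proof.
  intros Hr HV Hab HP HW t Ht.
  eexists. split.
  - apply (is_derive_plus (tang hx hy kx ky th) (fun s => V * s) t).
    + eapply is_derive_tang; [eapply polar_x | eapply polar_y | eapply window_x
        | eapply window_y | eapply polar_th]; eauto.
    + auto_derive; [exact I | reflexivity].
  - unfold plus; simpl.
    pose proof (dot_unit_bound _ _ _ (th t) HV (window_speed _ _ _ _ _ _ _ _ _ _ _ HW t Ht)) as Hb.
    apply Rabs_le_between in Hb.
    pose proof (sin2_cos2 (th t)) as E. unfold Rsqr in E.
    assert (sg t * cos (th t) * cos (th t) + sg t * sin (th t) * sin (th t) = sg t).
    { replace (sg t) with (sg t * (sin (th t) * sin (th t) + cos (th t) * cos (th t))) at 3 by (rewrite E; ring). ring. }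
    lra.
Qed.

Lemma Rabs_lt_of_sqr (x y r : R) : 0 < r -> x ^ 2 + y ^ 2 < r ^ 2 ->
  - r < x < r /\ - r < y < r.
Proof. intros. split; split; nra. Qed.

Lemma tang_nrml_bound rho V eta hx hy kx ky vx vy th a b t : 0 < rho ->
  window rho V eta hx hy kx ky vx vy a b -> a <= t <= b ->
  - rho < tang hx hy kx ky th t < rho /\ - rho < nrml hx hy kx ky th t < rho.
Proof.
  intros Hr HW Ht. apply Rabs_lt_of_sqr; [exact Hr|].
  rewrite tang_nrml_sqr. eapply window_close; eauto.
Qed.

(** The curvature bound gives |w nrml| <= |w| rho <= sg, so the derivative is nonnegative. *)
Lemma tang_drift_mono rho V eta hx hy kx ky vx vy sg th w len a b :
  0 < rho -> 0 <= V -> a <= b ->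
  polar rho hx hy sg th w len a b -> window rho V eta hx hy kx ky vx vy a b ->
  tang hx hy kx ky th a + V * a <= tang hx hy kx ky th b + V * b.
Proof.
  intros Hr HV Hab HP HW.
  pose proof (tang_drift _ _ _ _ _ _ _ _ _ _ _ _ _ _ _ Hr HV Hab HP HW) as HD.
  apply (derive_nonneg_le (fun s => tang hx hy kx ky th s + V * s)); [exact Hab|].
  intros t Ht. destruct (HD t Ht) as [l [Hl Hge]]. exists l. split; [exact Hl|].
  destruct (tang_nrml_bound _ _ _ _ _ _ _ _ _ th _ _ _ Hr HW Ht) as [_ HN].
  pose proof (polar_curv _ _ _ _ _ _ _ _ _ HP t Ht).
  pose proof (Rabs_pos (w t)).
  assert (Rabs (w t * nrml hx hy kx ky th t) <= Rabs (w t) * rho).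
  { rewrite Rabs_mult. apply Rmult_le_compat_l; [lra|]. apply Rabs_le; lra. }
  pose proof (Rle_abs (- (w t * nrml hx hy kx ky th t))) as Ha.
  rewrite Rabs_Ropp in Ha. lra.
Qed.

(* The point at distance [rho] to the left of [h] moves along [u], hence backwards
   relative to [k] in the direction [e = (cos eta, sin eta)], although being [rho]-close
   to [k] at both ends would require it to move forwards. *)
Lemma no_backward_half_turn rho V eta hx hy kx ky vx vy sg th w len a b :
  0 < rho -> a <= b ->
  polar rho hx hy sg th w len a b -> window rho V eta hx hy kx ky vx vy a b ->
  th a = eta + PI / 2 -> th b = eta + PI / 2 + PI ->
  (forall t, a <= t <= b -> th a <= th t <= th b) -> False.
Proof.
  intros Hr Hab HP HW Ha Hb Hm.
  (* [H] is the component along [e] of the vector from [k] to the centre of the circle of radius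
     [rho] tangent to [h] on its left. *)
  set (H t := (hx t - kx t - rho * sin (th t)) * cos eta
            + (hy t - ky t + rho * cos (th t)) * sin eta).
  assert (Hle : - H a <= - H b).
  { apply (derive_nonneg_le (fun t => - H t)); [exact Hab|].
    intros t Ht.
    exists ((vx t * cos eta + vy t * sin eta) - (sg t - rho * w t) * cos (th t - eta)).
    split.
    - unfold H.
      pose proof (polar_x _ _ _ _ _ _ _ _ _ HP t Ht) as H1.
      pose proof (polar_y _ _ _ _ _ _ _ _ _ HP t Ht) as H2.
      pose proof (window_x _ _ _ _ _ _ _ _ _ _ _ HW t Ht) as H3.
      pose proof (window_y _ _ _ _ _ _ _ _ _ _ _ HW t Ht) as H4.
      pose proof (polar_th _ _ _ _ _ _ _ _ _ HP t Ht) as H5.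
      auto_derive; [repeat split; eexists; eassumption|].
      rewrite (is_derive_unique (fun x : R => hx x) t _ H1), (is_derive_unique (fun x : R => hy x) t _ H2),
        (is_derive_unique (fun x : R => kx x) t _ H3), (is_derive_unique (fun x : R => ky x) t _ H4),
        (is_derive_unique (fun x : R => th x) t _ H5), cos_minus. ring.
    - pose proof (window_fwd _ _ _ _ _ _ _ _ _ _ _ HW t Ht).
      pose proof (polar_curv _ _ _ _ _ _ _ _ _ HP t Ht).
      pose proof (Rle_abs (w t)).
      specialize (Hm t Ht).
      assert (cos (th t - eta) <= 0) by (apply cos_le_0; lra).
      assert (0 <= sg t - rho * w t) by nra.
      nra. }
  (* At [a] the left normal of [h] is [- e] and at [b] it is [e], so the centre is offset by
     [- rho], then by [rho]. *)
  assert (Hva : H a = (hx a - kx a) * cos eta + (hy a - ky a) * sin eta - rho).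
  { unfold H. rewrite Ha, sin_plus, cos_plus, sin_PI2, cos_PI2.
    pose proof (sin2_cos2 eta) as E. unfold Rsqr in E.
    replace rho with (rho * (sin eta * sin eta + cos eta * cos eta)) at 3 by (rewrite E; ring).
    ring. }
  assert (Hvb : H b = (hx b - kx b) * cos eta + (hy b - ky b) * sin eta + rho).
  { unfold H. rewrite Hb, neg_sin, neg_cos, sin_plus, cos_plus, sin_PI2, cos_PI2.
    pose proof (sin2_cos2 eta) as E. unfold Rsqr in E.
    replace rho with (rho * (sin eta * sin eta + cos eta * cos eta)) at 3 by (rewrite E; ring).
    ring. }
  (* The constant angle [eta] turns [tang] into the component along [e], of modulus below [rho].
     Hence [H a < 0 < H b], against [Hle]. *)
  pose proof (tang_nrml_bound _ _ _ _ _ _ _ _ _ (fun _ => eta) _ _ a Hr HW) as Ba.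
  pose proof (tang_nrml_bound _ _ _ _ _ _ _ _ _ (fun _ => eta) _ _ b Hr HW) as Bb.
  unfold tang in Ba, Bb. lra.
Qed.

Lemma angle_mod_2PI (x y : R) : exists n : Z, y <= x + IZR n * (2 * PI) <= y + 2 * PI.
Proof.
  pose proof PI_RGT_0.
  destruct (archimed ((y - x) / (2 * PI))) as [H1 H2].
  exists (up ((y - x) / (2 * PI))).
  set (n := IZR (up ((y - x) / (2 * PI)))) in *.
  assert (E : (y - x) / (2 * PI) * (2 * PI) = y - x) by (field; lra).
  split; nra.
Qed.

(** * Length within a window *)

Lemma trig_shift_nat (x : R) (n : nat) :
  cos (x + INR n * (2 * PI)) = cos x /\ sin (x + INR n * (2 * PI)) = sin x.
Proof.
  replace (x + INR n * (2 * PI)) with (x + 2 * INR n * PI) by ring.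
  now rewrite cos_period, sin_period.
Qed.

Lemma angle_representative (x y : R) : exists a,
  y <= a <= y + 2 * PI /\ cos a = cos x /\ sin a = sin x.
Proof.
  destruct (angle_mod_2PI x y) as [n Hn].
  exists (x + IZR n * (2 * PI)). split; [exact Hn|].
  destruct (Z_le_gt_dec 0 n) as [H|H].
  - destruct (Z_of_nat_complete n H) as [m ->]. rewrite <- INR_IZR_INZ.
    apply trig_shift_nat.
  - destruct (Z_of_nat_complete (- n)) as [m Hm]; [lia|].
    destruct (trig_shift_nat (x + IZR n * (2 * PI)) m) as [E1 E2].
    rewrite INR_IZR_INZ, <- Hm, opp_IZR in E1, E2.
    replace (x + IZR n * (2 * PI) + - IZR n * (2 * PI)) with x in E1, E2 by ring.
    now split.
Qed.

(** With nonpositive normal component, tang + V s grows at least as fast as (len - rho th) / 2. A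
    gain below rho / 8 over length 4 pi rho thus forces a left turn of at least 3 pi, which contains
    an impossible backward half turn. *)
Lemma left_chunk_gain rho V eta hx hy kx ky vx vy sg th w len c d :
  0 < rho -> 0 <= V -> c <= d ->
  polar rho hx hy sg th w len c d -> window rho V eta hx hy kx ky vx vy c d ->
  (forall t, c <= t <= d -> nrml hx hy kx ky th t <= 0) ->
  4 * PI * rho <= len d - len c ->
  tang hx hy kx ky th c + V * c + rho / 8 <= tang hx hy kx ky th d + V * d.
Proof.
  intros Hr HV Hcd HP HW HN HL. apply Rnot_lt_le. intros Hgain.
  pose proof (tang_drift _ _ _ _ _ _ _ _ _ _ _ _ _ _ _ Hr HV Hcd HP HW) as HD.
  assert (Hle := derive_nonneg_le (fun s => tang hx hy kx ky th s + V * s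
                                 - (len s - rho * th s) / 2) c d Hcd).
  assert (Hturn : th c + 3 * PI <= th d).
  { simpl in Hle. lapply Hle; [clear Hle; intros Hle|].
    - pose proof PI2_3_2. nra.
    - intros t Ht. destruct (HD t Ht) as [l [Hl Hge]].
      exists (l - (sg t - rho * w t) / 2). split.
      + apply (is_derive_minus (fun s => tang hx hy kx ky th s + V * s)
          (fun s => (len s - rho * th s) / 2)); [exact Hl|].
        pose proof (polar_len _ _ _ _ _ _ _ _ _ HP t Ht) as H1.
        pose proof (polar_th _ _ _ _ _ _ _ _ _ HP t Ht) as H2.
        auto_derive; [repeat split; eexists; eassumption|].
        rewrite (is_derive_unique (fun x : R => len x) t _ H1),
          (is_derive_unique (fun x : R => th x) t _ H2). field.
      + destruct (tang_nrml_bound _ _ _ _ _ _ _ _ _ th _ _ _ Hr HW Ht) as [_ HB].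
        pose proof (polar_curv _ _ _ _ _ _ _ _ _ HP t Ht) as Hc.
        specialize (HN t Ht). pose proof (Rabs_pos (w t)).
        (* The sign of the normal component puts [nrml + rho / 2] between [- rho / 2] and
           [rho / 2]. *)
        assert (Rabs (w t * (nrml hx hy kx ky th t + rho / 2)) <= Rabs (w t) * (rho / 2)).
        { rewrite Rabs_mult. apply Rmult_le_compat_l; [lra|]. apply Rabs_le; lra. }
        pose proof (Rle_abs (- (w t * (nrml hx hy kx ky th t + rho / 2)))) as Ha.
        rewrite Rabs_Ropp in Ha. lra. }
  (* The range from [th c] to [th c + 3 * PI] contains some [a, a + pi] with [a] congruent to eta +
     pi / 2 modulo 2 pi. *)
  destruct (angle_representative (eta + PI / 2) (th c)) as [a [Ha [Ec Es]]].
  pose proof PI_RGT_0.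
  destruct (continuous_crossing th a (a + PI) c d) as [s [t [Hst [Htd [Hs [Ht Hm]]]]]]; try lra.
  { intros t Ht. eapply is_derive_continuity_pt, polar_th; eauto. }
  (* [a - PI / 2] gives the same direction as [eta], with no multiple of 2 pi left to adjust. *)
  apply (no_backward_half_turn rho V (a - PI / 2) hx hy kx ky vx vy sg th w len s t);
    try lra.
  - eapply polar_sub; [| |exact HP]; lra.
  - destruct (window_sub _ _ _ _ _ _ _ _ _ _ _ s t (proj1 Hst) Htd HW) as [W1 W2 W3 W4 W5].
    split; auto. intros u Hu. specialize (W4 u Hu).
    rewrite cos_minus, sin_minus, Ec, Es, cos_plus, sin_plus, cos_PI2, sin_PI2. lra.
  - rewrite Hs, Ht. exact Hm.
Qed.

(** The velocity of [h] has no normal part, that of [k] contributes at most [V], and the rotation of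
    the frame at most |w| rho <= sg. *)
Lemma nrml_lipschitz rho V eta hx hy kx ky vx vy sg th w len c d :
  0 < rho -> 0 <= V -> c <= d ->
  polar rho hx hy sg th w len c d -> window rho V eta hx hy kx ky vx vy c d ->
  Rabs (nrml hx hy kx ky th d - nrml hx hy kx ky th c) <= len d - len c + V * (d - c).
Proof.
  intros Hr HV Hcd HP HW.
  assert (Hn : forall t, c <= t <= d -> exists l,
    is_derive (nrml hx hy kx ky th) t l /\ Rabs l <= sg t + V).
  { intros t Ht. eexists. split.
    - eapply is_derive_nrml; [eapply polar_x | eapply polar_y | eapply window_x
        | eapply window_y | eapply polar_th]; eauto.
    - destruct (tang_nrml_bound _ _ _ _ _ _ _ _ _ th _ _ _ Hr HW Ht) as [HB _].
      pose proof (polar_curv _ _ _ _ _ _ _ _ _ HP t Ht) as Hc.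
      (* The angle th - pi / 2 is that of the right normal, so this bounds the normal velocity of
         [k]. *)
      pose proof (dot_unit_bound _ _ _ (th t - PI / 2) HV
        (window_speed _ _ _ _ _ _ _ _ _ _ _ HW t Ht)) as Hb.
      rewrite cos_minus, sin_minus, cos_PI2, sin_PI2 in Hb.
      assert (H : Rabs (w t * tang hx hy kx ky th t) <= Rabs (w t) * rho).
      { rewrite Rabs_mult. apply Rmult_le_compat_l; [apply Rabs_pos|]. apply Rabs_le; lra. }
      apply Rabs_le_between in Hb, H. apply Rabs_le. lra. }
  assert (Hs : forall s, s = 1 \/ s = -1 ->
    s * (nrml hx hy kx ky th d - nrml hx hy kx ky th c) <= len d - len c + V * (d - c)).
  { intros s Hs.
    assert (Hle := derive_nonneg_le
      (fun t => len t + V * t - s * nrml hx hy kx ky th t) c d Hcd).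
    simpl in Hle. lapply Hle; [lra|]. intros t Ht.
    destruct (Hn t Ht) as [l [Hl Hb]].
    exists (sg t + V - s * l). split.
    - apply (is_derive_minus (fun t => len t + V * t) (fun t => s * nrml hx hy kx ky th t)).
      + apply (is_derive_plus len (fun t => V * t)); [eapply polar_len; eauto|].
        auto_derive; [exact I|ring].
      + apply (is_derive_scal (nrml hx hy kx ky th)), Hl.
    - apply Rabs_le_between in Hb. destruct Hs as [-> | ->]; lra. }
  apply Rabs_le. pose proof (Hs 1 (or_introl eq_refl)).
  pose proof (Hs (-1) (or_intror eq_refl)). lra.
Qed.

Lemma len_mono rho hx hy sg th w len a b : a <= b ->
  polar rho hx hy sg th w len a b -> len a <= len b.
Proof.
  intros Hab HP. apply (derive_nonneg_le len); [exact Hab|].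
  intros t Ht. exists (sg t). split; [eapply polar_len; eauto|].
  apply Rlt_le. eapply polar_speed; eauto.
Qed.

(** Starting from its zero at [tau], the normal component reaches at most rho / 4 + rho / 4 on so
    short a piece, so the tangential quantity increases at rate at least sg / 2. *)
Lemma short_chunk_gain rho V eta hx hy kx ky vx vy sg th w len s t tau :
  0 < rho -> 0 <= V -> s <= tau <= t ->
  polar rho hx hy sg th w len s t -> window rho V eta hx hy kx ky vx vy s t ->
  V * (t - s) <= rho / 4 -> len t - len s = rho / 4 -> nrml hx hy kx ky th tau = 0 ->
  tang hx hy kx ky th s + V * s + rho / 8 <= tang hx hy kx ky th t + V * t.
Proof.
  intros Hr HV Hst HP HW HV4 HL H0.
  assert (HN : forall u, s <= u <= t -> Rabs (nrml hx hy kx ky th u) <= rho / 2).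
  { intros u Hu.
    assert (Hmono : forall a b, s <= a -> a <= b -> b <= t -> len a <= len b).
    { intros. eapply len_mono; [|eapply polar_sub; [| |exact HP]]; lra. }
    assert (Hlip : forall a b, s <= a -> a <= b -> b <= t ->
      Rabs (nrml hx hy kx ky th b - nrml hx hy kx ky th a) <= len b - len a + V * (b - a)).
    { intros. eapply nrml_lipschitz; eauto; [eapply polar_sub; [| |exact HP]
        | eapply window_sub; [| |exact HW]]; lra. }
    destruct (Rle_lt_dec u tau).
    - specialize (Hlip u tau). rewrite H0 in Hlip.
      rewrite Rminus_0_l, Rabs_Ropp in Hlip.
      pose proof (Hmono s u). pose proof (Hmono tau t).
      specialize (Hlip ltac:(lra) ltac:(lra) ltac:(lra)).
      assert (V * (tau - u) <= V * (t - s)) by (apply Rmult_le_compat_l; lra). lra.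
    - specialize (Hlip tau u). rewrite H0, Rminus_0_r in Hlip.
      pose proof (Hmono s tau). pose proof (Hmono u t).
      specialize (Hlip ltac:(lra) ltac:(lra) ltac:(lra)).
      assert (V * (u - tau) <= V * (t - s)) by (apply Rmult_le_compat_l; lra). lra. }
  assert (Hst' : s <= t) by lra.
  pose proof (tang_drift _ _ _ _ _ _ _ _ _ _ _ _ _ _ _ Hr HV Hst' HP HW) as HD.
  assert (Hle := derive_nonneg_le
    (fun u => tang hx hy kx ky th u + V * u - / 2 * len u) s t Hst').
  simpl in Hle. lapply Hle; [lra|].
  intros u Hu. destruct (HD u Hu) as [l [Hl Hge]].
  exists (l - / 2 * sg u). split.
  - apply (is_derive_minus (fun s => tang hx hy kx ky th s + V * s) (fun s => / 2 * len s));
      [exact Hl|].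
    apply (is_derive_scal len). eapply polar_len; eauto.
  - pose proof (polar_curv _ _ _ _ _ _ _ _ _ HP u Hu) as Hc.
    assert (Rabs (w u * nrml hx hy kx ky th u) <= Rabs (w u) * (rho / 2)).
    { rewrite Rabs_mult. apply Rmult_le_compat_l; [apply Rabs_pos|]. apply HN; lra. }
    pose proof (Rle_abs (- (w u * nrml hx hy kx ky th u))) as Ha.
    rewrite Rabs_Ropp in Ha. lra.
Qed.

Lemma tang_mirror hx hy kx ky th t :
  tang hx (fun t => - hy t) kx (fun t => - ky t) (fun t => - th t) t = tang hx hy kx ky th t.
Proof. unfold tang. rewrite cos_neg, sin_neg. ring. Qed.

Lemma nrml_mirror hx hy kx ky th t :
  nrml hx (fun t => - hy t) kx (fun t => - ky t) (fun t => - th t) t = - nrml hx hy kx ky th t.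
Proof. unfold nrml. rewrite cos_neg, sin_neg. ring. Qed.

(** If the normal component vanishes somewhere, a short piece next to that zero gives the gain.
    Otherwise its sign is constant and the whole chunk is used, after reflection if the sign is
    positive. *)
Lemma chunk_gain rho V eta hx hy kx ky vx vy sg th w len c d :
  0 < rho -> 0 <= V -> c <= d ->
  polar rho hx hy sg th w len c d -> window rho V eta hx hy kx ky vx vy c d ->
  V * (d - c) <= rho / 4 -> 4 * PI * rho <= len d - len c ->
  tang hx hy kx ky th c + V * c + rho / 8 <= tang hx hy kx ky th d + V * d.
Proof.
  intros Hr HV Hcd HP HW HV4 HL.
  set (N := nrml hx hy kx ky th).
  assert (HNc : forall t, c <= t <= d -> continuity_pt N t).
  { intros t Ht. eapply is_derive_continuity_pt, is_derive_nrml;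
      [eapply polar_x | eapply polar_y | eapply window_x
        | eapply window_y | eapply polar_th]; eauto. }
  destruct (classic (exists tau, c <= tau <= d /\ N tau = 0)) as [[tau [Htau H0]]|Hno].
  - assert (Hlc : forall t, c <= t <= d -> continuity_pt len t).
    { intros t Ht. eapply is_derive_continuity_pt, polar_len; eauto. }
    assert (Hmono : forall a b, c <= a -> a <= b -> b <= d ->
      tang hx hy kx ky th a + V * a <= tang hx hy kx ky th b + V * b).
    { intros. eapply tang_drift_mono; eauto; [eapply polar_sub; [| |exact HP]
        | eapply window_sub; [| |exact HW]]; lra. }
    (* The chunk is longer than rho / 2, so one side of [tau] has length at least rho / 4. *)
    assert (Hshort : exists s t, c <= s <= tau /\ tau <= t <= d /\ len t - len s = rho / 4).
    { pose proof PI2_3_2.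
      destruct (Rle_lt_dec (rho / 4) (len d - len tau)).
      - destruct (ivt_le len (len tau + rho / 4) tau d) as [t [Ht E]]; try lra.
        { intros; apply Hlc; lra. }
        exists tau, t. lra.
      - destruct (ivt_le len (len tau - rho / 4) c tau) as [s [Hs E]]; try lra.
        { intros; apply Hlc; lra. }
        { split; [|lra]. assert (rho <= 4 * PI * rho) by nra. lra. }
        exists s, tau. lra. }
    destruct Hshort as [s [t [Hs [Ht E]]]].
    assert (tang hx hy kx ky th s + V * s + rho / 8 <= tang hx hy kx ky th t + V * t).
    { eapply (short_chunk_gain rho V eta hx hy kx ky vx vy sg th w len s t tau); auto; try lra.
      - eapply polar_sub; [| |exact HP]; lra.
      - eapply window_sub; [| |exact HW]; lra.
      - assert (V * (t - s) <= V * (d - c)) by (apply Rmult_le_compat_l; lra). lra. }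
    pose proof (Hmono c s). pose proof (Hmono t d). lra.
  - destruct (Rle_lt_dec (N c) 0) as [Hc|Hc].
    + eapply left_chunk_gain; eauto. intros t Ht. fold N. apply Rnot_lt_le. intros Hpos.
      destruct (ivt_le N 0 c t) as [tau [Ht1 E]]; try lra.
      { intros; apply HNc; lra. }
      apply Hno. exists tau. split; [lra|exact E].
    + pose proof (left_chunk_gain _ _ _ _ _ _ _ _ _ _ _ _ _ c d Hr HV Hcd
        (polar_mirror _ _ _ _ _ _ _ _ _ HP) (window_mirror _ _ _ _ _ _ _ _ _ _ _ HW)) as HG.
      rewrite !tang_mirror in HG. apply HG; [|exact HL].
      intros t Ht. rewrite nrml_mirror. fold N. apply Rnot_lt_le. intros Hneg.
      destruct (ivt_le (fun t => - N t) 0 c t) as [tau [Ht1 E]]; try (unfold N in *; lra).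
      { intros; apply (continuity_pt_opp N), HNc; lra. }
      apply Hno. exists tau. split; [lra|lra].
Qed.

(** Each chunk of length 4 pi rho yields a gain of rho / 8, while the total gain is less than 2 rho
    + rho / 4, which is 18 times rho / 8. *)
Lemma window_length rho V eta hx hy kx ky vx vy sg th w len a b :
  0 < rho -> 0 <= V -> a <= b ->
  polar rho hx hy sg th w len a b -> window rho V eta hx hy kx ky vx vy a b ->
  V * (b - a) <= rho / 4 -> len b - len a <= 72 * PI * rho.
Proof.
  intros Hr HV Hab HP HW HV4. pose proof PI_RGT_0.
  assert (Hn : forall n b', a <= b' <= b -> INR n * (4 * PI * rho) <= len b' - len a ->
    tang hx hy kx ky th a + V * a + INR n * (rho / 8) <= tang hx hy kx ky th b' + V * b').
  { induction n as [|n IH]; intros b' Hb' HL.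
    - rewrite Rmult_0_l, Rplus_0_r. apply (tang_drift_mono rho V eta hx hy kx ky vx vy sg th w len); auto; [lra| |].
      + eapply polar_sub; [| |exact HP]; lra.
      + eapply window_sub; [| |exact HW]; lra.
    - rewrite S_INR in *. assert (0 < 4 * PI * rho) by nra.
      pose proof (pos_INR n).
      destruct (ivt_le len (len b' - 4 * PI * rho) a b') as [c [Hc E]]; [lra| |nra|].
      { intros. eapply is_derive_continuity_pt, polar_len; eauto; lra. }
      specialize (IH c ltac:(lra) ltac:(lra)).
      assert (tang hx hy kx ky th c + V * c + rho / 8
              <= tang hx hy kx ky th b' + V * b'); [|lra].
      apply (chunk_gain rho V eta hx hy kx ky vx vy sg th w len); auto; try lra.
      + eapply polar_sub; [| |exact HP]; lra.
      + eapply window_sub; [| |exact HW]; lra.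
      + assert (V * (b' - c) <= V * (b - a)) by (apply Rmult_le_compat_l; lra). lra. }
  apply Rnot_lt_le. intros Hlt.
  specialize (Hn 18%nat b ltac:(lra)). simpl INR in Hn.
  specialize (Hn ltac:(lra)).
  destruct (tang_nrml_bound _ _ _ _ _ _ _ _ _ th _ _ a Hr HW) as [Ba _]; [lra|].
  destruct (tang_nrml_bound _ _ _ _ _ _ _ _ _ th _ _ b Hr HW) as [Bb _]; [lra|].
  lra.
Qed.

(** * Polar form of a trajectory *)

(** Meant for an open interval slightly larger than the time domain, so that primitives have
    two-sided derivatives at both ends. *)
Lemma is_derive_RInt_open (f : R -> R) (a b x0 t : R) :
  a < x0 < b -> a < t < b -> (forall s, a < s < b -> continuity_pt f s) ->
  is_derive (fun s => RInt f x0 s) t (f t).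
Proof.
  intros H0 Ht Hf.
  assert (Hc : forall s, a < s < b -> continuous f s).
  { intros s Hs. apply continuity_pt_filterlim, Hf, Hs. }
  apply (is_derive_RInt f (fun s => RInt f x0 s) x0 t); [|apply Hc, Ht].
  assert (He : 0 < Rmin (t - a) (b - t)) by (apply Rmin_pos; lra).
  exists (mkposreal _ He). intros y Hy.
  apply (@RInt_correct R_CompleteNormedModule), (@ex_RInt_continuous R_CompleteNormedModule).
  intros z Hz. apply Hc.
  unfold ball in Hy; simpl in Hy. unfold AbsRing_ball, abs, minus, plus, opp in Hy; simpl in Hy.
  pose proof (Rmin_l (t - a) (b - t)). pose proof (Rmin_r (t - a) (b - t)).
  apply Rabs_def2 in Hy.
  revert Hz. unfold Rmin, Rmax. destruct (Rle_dec x0 y); lra.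
Qed.

(** The angle is defined as the primitive of the turning rate [w], starting from the direction of
    the initial velocity; that it is the tangent angle is then checked by differentiation. *)
Lemma polar_exists (kmax : R) (h : traj) : 0 < kmax -> is_traj kmax h ->
  exists sg th w len, polar (/ kmax) (gx h) (gy h) sg th w len 0 (T h) /\ len 0 = 0.
Proof.
  intros Hk [HT [[d1 [Hd1 Hx]] [[d2 [Hd2 Hy]] [Hs Hcv]]]].
  set (p := Derive (gx h)) in *. set (q := Derive (gy h)) in *.
  set (p1 := Derive p) in *. set (q1 := Derive q) in *.
  assert (Hs2c : forall t, - Rmin d1 d2 < t < T h + Rmin d1 d2 ->
    continuity_pt p t /\ continuity_pt q t /\ continuity_pt p1 t /\ continuity_pt q1 t /\
    continuity_pt (speed2 h) t).
  { intros t Ht. pose proof (Rmin_l d1 d2). pose proof (Rmin_r d1 d2).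
    destruct (Hx t) as [_ [Hx1 Hx2]]; [lra|]. destruct (Hy t) as [_ [Hy1 Hy2]]; [lra|].
    assert (continuity_pt p t) by (apply continuity_pt_filterlim, (ex_derive_continuous p), Hx1).
    assert (continuity_pt q t) by (apply continuity_pt_filterlim, (ex_derive_continuous q), Hy1).
    repeat split; auto.
    - apply continuity_pt_filterlim, Hx2.
    - apply continuity_pt_filterlim, Hy2.
    - apply (continuity_pt_plus (fun t => p t ^ 2) (fun t => q t ^ 2));
        [apply (continuity_pt_comp p (fun x => x ^ 2)) | apply (continuity_pt_comp q (fun x => x ^ 2))];
        auto; apply derivable_continuous_pt, derivable_pt_pow. }
  assert (Hm : 0 < Rmin d1 d2) by (apply Rmin_pos; lra).
  assert (Hnear : forall t, 0 <= t <= T h -> exists e, 0 < e /\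
    forall s, Rabs (s - t) < e -> 0 < speed2 h s).
  { intros t Ht. destruct (locally_false_le (speed2 h) 0 t) as [e [He Hf]].
    - apply Hs2c; lra.
    - specialize (Hs t Ht). lra.
    - exists e. split; [exact He|]. intros s Hse. specialize (Hf s Hse). simpl in Hf. lra. }
  destruct (Hnear 0) as [e1 [He1 Hf1]]; [lra|].
  destruct (Hnear (T h)) as [e2 [He2 Hf2]]; [lra|].
  (* A margin around the time domain on which the derivatives exist and the speed stays positive. *)
  set (d := Rmin (Rmin d1 d2) (Rmin e1 e2)).
  assert (Hd : 0 < d) by (apply Rmin_pos; [lra|apply Rmin_pos; lra]).
  assert (Hdm : d <= Rmin d1 d2) by apply Rmin_l.
  assert (Hde : d <= Rmin e1 e2) by apply Rmin_r.
  pose proof (Rmin_l e1 e2). pose proof (Rmin_r e1 e2).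
  assert (Hpos : forall t, - d < t < T h + d -> 0 < speed2 h t).
  { intros t Ht. destruct (Rlt_le_dec t 0); [apply Hf1, Rabs_def1; lra|].
    destruct (Rle_lt_dec t (T h)); [apply Hs; lra|apply Hf2, Rabs_def1; lra]. }
  set (sg := fun t => sqrt (speed2 h t)).
  set (w := fun t => (p t * q1 t - q t * p1 t) / speed2 h t).
  assert (Hsg : forall t, - d < t < T h + d -> 0 < sg t /\ sg t * sg t = p t ^ 2 + q t ^ 2).
  { intros t Ht. specialize (Hpos t Ht). split; [apply sqrt_lt_R0, Hpos|].
    unfold sg. rewrite sqrt_sqrt by lra. reflexivity. }
  assert (Hsgc : forall t, - d < t < T h + d -> continuity_pt sg t).
  { intros t Ht. apply (continuity_pt_comp (speed2 h) sqrt); [apply Hs2c; lra|].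
    apply continuity_pt_sqrt. specialize (Hpos t Ht). lra. }
  assert (Hwc : forall t, - d < t < T h + d -> continuity_pt w t).
  { intros t Ht. destruct (Hs2c t) as [C1 [C2 [C3 [C4 C5]]]]; [lra|].
    apply (continuity_pt_div (fun t => p t * q1 t - q t * p1 t) (speed2 h)); auto.
    - apply (continuity_pt_minus (fun t => p t * q1 t) (fun t => q t * p1 t));
        [apply (continuity_pt_mult p q1)|apply (continuity_pt_mult q p1)]; auto.
    - specialize (Hpos t Ht). lra. }
  destruct (unit_vector_angle (p 0 / sg 0) (q 0 / sg 0)) as [th0 [Hc0 Hs0]].
  { destruct (Hsg 0) as [P E]; [lra|].
    replace ((p 0 / sg 0) ^ 2 + (q 0 / sg 0) ^ 2)
      with ((p 0 ^ 2 + q 0 ^ 2) / (sg 0 * sg 0)) by (field; lra).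
    rewrite E. field. rewrite <- E. nra. }
  set (th := fun t => th0 + RInt w 0 t).
  assert (Hth : forall t, - d < t < T h + d -> is_derive th t (w t)).
  { intros t Ht. replace (w t) with (0 + w t) by ring.
    apply (is_derive_plus (fun _ => th0) (fun t => RInt w 0 t)).
    - apply (@is_derive_const R_AbsRing).
    - apply (is_derive_RInt_open w (- d) (T h + d)); auto; lra. }
  assert (Hdir : forall t, 0 <= t <= T h -> p t = sg t * cos (th t) /\ q t = sg t * sin (th t)).
  (* The cosine of the angle between the velocity and [(cos th, sin th)] is constant, hence equal to
     its initial value 1. *)
  { assert (HA : forall t, - d < t < T h + d ->
      is_derive (fun t => (p t * cos (th t) + q t * sin (th t)) / sg t) t 0).
    { intros t Ht. destruct (Hsg t Ht) as [P E].
      destruct (Hx t) as [_ [Dp _]]; [pose proof (Rmin_l d1 d2); lra|].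
      destruct (Hy t) as [_ [Dq _]]; [pose proof (Rmin_r d1 d2); lra|].
      specialize (Hth t Ht).
      apply Derive_correct in Dp, Dq. fold p1 in Dp. fold q1 in Dq.
      assert (Dsg : is_derive sg t ((p t * p1 t + q t * q1 t) / sg t)).
      { replace ((p t * p1 t + q t * q1 t) / sg t)
          with ((2 * (p t * p1 t + q t * q1 t)) / (2 * sqrt (speed2 h t)))
          by (fold (sg t); field; lra).
        apply (is_derive_sqrt (speed2 h)); [|apply Hpos, Ht].
        unfold speed2. fold p q.
        auto_derive; [repeat split; eexists; eassumption|].
        rewrite (is_derive_unique (fun x : R => p x) t _ Dp),
          (is_derive_unique (fun x : R => q x) t _ Dq). ring. }
      auto_derive; [repeat split; try (eexists; eassumption); lra|].
      rewrite (is_derive_unique (fun x : R => p x) t _ Dp),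
          (is_derive_unique (fun x : R => q x) t _ Dq),
          (is_derive_unique (fun x : R => th x) t _ Hth),
          (is_derive_unique (fun x : R => sg x) t _ Dsg).
      unfold w, speed2. fold p q.
      assert (Hn : p t ^ 2 + q t ^ 2 <> 0) by (rewrite <- E; nra).
      field_simplify_eq; [|split; lra].
      replace (sg t ^ 2) with (p t ^ 2 + q t ^ 2) by (rewrite <- E; ring).
      ring. }
    intros t Ht.
    assert (E1 : (p t * cos (th t) + q t * sin (th t)) / sg t = 1).
    { assert (E0 : (p 0 * cos (th 0) + q 0 * sin (th 0)) / sg 0 = 1).
      { unfold th. rewrite RInt_point. unfold zero; simpl. rewrite Rplus_0_r.
        replace ((p 0 * cos th0 + q 0 * sin th0) / sg 0)
          with (cos th0 * (p 0 / sg 0) + sin th0 * (q 0 / sg 0)) by (unfold Rdiv; ring).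
        rewrite Hc0, Hs0. pose proof (sin2_cos2 th0) as E. unfold Rsqr in E. lra. }
      destruct (Req_dec t 0) as [->|]; [exact E0|].
      destruct (mean_value (fun t => (p t * cos (th t) + q t * sin (th t)) / sg t)
        (fun l => l = 0) 0 t) as [c [l [_ [_ [-> E]]]]]; [lra| |lra].
      intros s Hst. exists 0. split; [apply HA; lra|reflexivity]. }
    destruct (Hsg t) as [P E]; [lra|].
    assert (E2 : p t * cos (th t) + q t * sin (th t) = sg t).
    { apply (f_equal (fun z => z * sg t)) in E1. field_simplify in E1; lra. }
    pose proof (sin2_cos2 (th t)) as E3. unfold Rsqr in E3.
    assert (E4 : (p t - sg t * cos (th t)) ^ 2 + (q t - sg t * sin (th t)) ^ 2 = 0).
    { replace ((p t - sg t * cos (th t)) ^ 2 + (q t - sg t * sin (th t)) ^ 2)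
        with (p t ^ 2 + q t ^ 2 - 2 * sg t * (p t * cos (th t) + q t * sin (th t))
          + sg t * sg t * (sin (th t) * sin (th t) + cos (th t) * cos (th t))) by ring.
      rewrite E2, E3, <- E. ring. }
    destruct (Rplus_sqr_eq_0 (p t - sg t * cos (th t)) (q t - sg t * sin (th t)));
      [unfold Rsqr; lra | split; lra]. }
  exists sg, th, w, (fun t => RInt sg 0 t). split; [|simpl; rewrite RInt_point; reflexivity].
  split; intros t Ht.
  - destruct (Hdir t Ht) as [<- _]. apply Derive_correct, Hx. lra.
  - destruct (Hdir t Ht) as [_ <-]. apply Derive_correct, Hy. lra.
  - apply Hth. lra.
  - apply (is_derive_RInt_open sg (- d) (T h + d)); auto; lra.
  - apply Hsg. lra.
  - specialize (Hcv t Ht). specialize (Hs t Ht). unfold curvature in Hcv.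
    fold p q p1 q1 in Hcv. fold (sg t) in Hcv.
    destruct (Hsg t) as [P E]; [lra|].
    unfold w. unfold Rdiv. rewrite Rabs_mult, Rabs_inv, (Rabs_pos_eq (speed2 h t)) by lra.
    set (n := Rabs (p t * q1 t - q t * p1 t)) in *.
    apply (Rmult_le_reg_r kmax); [exact Hk|].
    replace (n * / speed2 h t * / kmax * kmax)
      with (n / (speed2 h t * sg t) * sg t) by (field; repeat split; lra).
    rewrite (Rmult_comm (sg t) kmax).
    apply Rmult_le_compat_r; lra.
Qed.

(** * Length of perturbations *)

Lemma C2_on_derive (f : R -> R) (a b t : R) : C2_on f a b -> a <= t <= b ->
  is_derive f t (Derive f t) /\ continuity_pt (Derive f) t.
Proof.
  intros [d [Hd Hf]] Ht. destruct (Hf t) as [H1 [H2 _]]; [lra|]. split.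
  - apply Derive_correct, H1.
  - apply continuity_pt_filterlim, (ex_derive_continuous (Derive f)), H2.
Qed.

(** By uniform continuity each velocity component varies by less than half the minimal speed over a
    duration [delta]; the velocity at the start of the window then serves as direction. *)
Lemma traj_windows (kmax : R) (g : traj) : is_traj kmax g ->
  exists V delta, 0 <= V /\ 0 < delta /\
    (forall t, 0 <= t <= T g -> speed2 g t <= V ^ 2) /\
    forall a, 0 <= a <= T g -> exists eta, forall t, a <= t <= a + delta -> t <= T g ->
      0 <= Derive (gx g) t * cos eta + Derive (gy g) t * sin eta.
Proof.
  intros [HT [Hx [Hy [Hs _]]]].
  set (p := Derive (gx g)) in *. set (q := Derive (gy g)) in *.
  assert (Cp : forall t, 0 <= t <= T g -> continuity_pt p t)
    by (intros; eapply C2_on_derive; eauto).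
  assert (Cq : forall t, 0 <= t <= T g -> continuity_pt q t)
    by (intros; eapply C2_on_derive; eauto).
  assert (Cs : forall t, 0 <= t <= T g -> continuity_pt (speed2 g) t).
  { intros t Ht. apply (continuity_pt_plus (fun t => p t ^ 2) (fun t => q t ^ 2));
      [apply (continuity_pt_comp p (fun x => x ^ 2)) | apply (continuity_pt_comp q (fun x => x ^ 2))];
      auto; apply derivable_continuous_pt, derivable_pt_pow. }
  destruct (continuity_ab_maj (speed2 g) 0 (T g)) as [M [HM HM']]; [lra|exact Cs|].
  destruct (continuity_ab_min (speed2 g) 0 (T g)) as [n [Hn Hn']]; [lra|exact Cs|].
  set (m := sqrt (speed2 g n)).
  assert (Hm : 0 < m) by (apply sqrt_lt_R0, Hs, Hn').
  assert (Em : m * m = speed2 g n) by (apply sqrt_sqrt, Rlt_le, Hs, Hn').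
  assert (Hm2 : 0 < m / 2) by lra.
  destruct (Heine p (fun c => 0 <= c <= T g) (compact_P3 0 (T g)) Cp (mkposreal _ Hm2))
    as [[d1 Hd1] U1].
  destruct (Heine q (fun c => 0 <= c <= T g) (compact_P3 0 (T g)) Cq (mkposreal _ Hm2))
    as [[d2 Hd2] U2].
  simpl in U1, U2.
  assert (Hd : 0 < Rmin d1 d2) by (apply Rmin_pos; lra).
  pose proof (Rmin_l d1 d2). pose proof (Rmin_r d1 d2).
  (* For z >= 0 one has z <= (1 + z)^2, which spares a square root. *)
  exists (1 + speed2 g M), (Rmin d1 d2 / 2). repeat split; try lra.
  - specialize (Hs M HM'). lra.
  - intros t Ht. specialize (HM t Ht). specialize (Hs M HM'). nra.
  - intros a Ha. set (A := sqrt (speed2 g a)).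
    assert (HA : 0 < A) by (apply sqrt_lt_R0, Hs, Ha).
    assert (EA : A * A = p a ^ 2 + q a ^ 2)
      by (unfold A; rewrite sqrt_sqrt by (apply Rlt_le, Hs, Ha); reflexivity).
    assert (HmA : m <= A) by (apply sqrt_le_1_alt, Hn, Ha).
    destruct (unit_vector_angle (p a / A) (q a / A)) as [eta [Ec Es]].
    { replace ((p a / A) ^ 2 + (q a / A) ^ 2) with ((p a ^ 2 + q a ^ 2) / (A * A))
        by (field; lra). rewrite <- EA. field. lra. }
    exists eta. intros t Ht HtT. rewrite <- Ec, <- Es.
    assert (Hpd : Rabs (p t - p a) < m / 2) by (apply U1; [lra|lra|apply Rabs_def1; lra]).
    assert (Hqd : Rabs (q t - q a) < m / 2) by (apply U2; [lra|lra|apply Rabs_def1; lra]).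
    replace (p t * (p a / A) + q t * (q a / A)) with ((p t * p a + q t * q a) / A)
      by (field; lra).
    apply Rle_div_r; [lra|]. rewrite Rmult_0_l.
    assert (Hpa : Rabs (p a) <= A) by (apply Rabs_le; split; nra).
    assert (Hqa : Rabs (q a) <= A) by (apply Rabs_le; split; nra).
    (* The product with the initial velocity is at least A^2 - 2 (m / 2) A, and m <= A. *)
    assert (H1 : Rabs ((p t - p a) * p a) <= m / 2 * A)
      by (rewrite Rabs_mult; apply Rmult_le_compat; auto using Rabs_pos; lra).
    assert (H2 : Rabs ((q t - q a) * q a) <= m / 2 * A)
      by (rewrite Rabs_mult; apply Rmult_le_compat; auto using Rabs_pos; lra).
    apply Rabs_le_between in H1, H2. nra.
Qed.

(** The windows depend on [g] alone, and each contributes length at most 72 pi rho whatever the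
    perturbation. *)
Lemma perturbation_length_bound (kmax : R) (g : traj) : 0 < kmax -> is_traj kmax g ->
  exists Lmax, forall gh, small_perturbation kmax g gh ->
    exists sg th w len, polar (/ kmax) (gx gh) (gy gh) sg th w len 0 (T gh) /\
      len 0 = 0 /\ len (T gh) <= Lmax.
Proof.
  intros Hk Hg.
  destruct (traj_windows kmax g Hg) as [V [delta [HV [Hdl [Hspeed Hdir]]]]].
  destruct Hg as [HT [Hx [Hy _]]].
  set (rho := / kmax). assert (Hr : 0 < rho) by (apply Rinv_0_lt_compat, Hk).
  (* The second entry keeps the drift [V * dl] within rho / 4; [V + 1] avoids a division by zero. *)
  set (dl := Rmin delta (rho / (4 * (V + 1)))).
  assert (Hq : 0 < rho / (4 * (V + 1))) by (apply Rdiv_lt_0_compat; lra).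
  assert (Hdl0 : 0 < dl) by (apply Rmin_pos; lra).
  assert (Hdl1 : dl <= delta) by apply Rmin_l.
  assert (Hdl2 : V * dl <= rho / 4).
  { apply Rle_trans with ((V + 1) * (rho / (4 * (V + 1)))); [|apply Req_le; field; lra].
    apply Rmult_le_compat; try lra. apply Rmin_r. }
  destruct (nfloor_ex (T g / dl)) as [n Hn]; [apply Rlt_le, Rdiv_lt_0_compat; lra|].
  (* [n] is a floor, so one more window is taken to cover the time domain. *)
  exists (INR (S n) * (72 * PI * rho)). intros gh [Hgh [ET [eps [Heps Hclose]]]].
  destruct (polar_exists kmax gh Hk Hgh) as [sg [th [w [len [HP Hl0]]]]].
  exists sg, th, w, len. split; [exact HP|]. split; [exact Hl0|].
  rewrite ET in *. fold rho in HP, Heps.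
  assert (Hind : forall k b, 0 <= b <= T g -> b <= INR k * dl ->
    len b <= INR k * (72 * PI * rho)).
  { induction k as [|k IH]; intros b Hb Hbk.
    - simpl in *. rewrite Rmult_0_l in *. replace b with 0 by lra. lra.
    - rewrite S_INR in *. set (a := Rmax 0 (b - dl)).
      assert (Ha : 0 <= a <= b /\ b - a <= dl /\ a <= INR k * dl).
      { unfold a, Rmax. pose proof (pos_INR k). destruct (Rle_dec 0 (b - dl)); nra. }
      destruct Ha as [Ha [Hba Hak]].
      specialize (IH a ltac:(lra) Hak).
      destruct (Hdir a) as [eta Heta]; [lra|].
      assert (len b - len a <= 72 * PI * rho); [|lra].
      apply (window_length rho V eta (gx gh) (gy gh) (gx g) (gy g)
        (Derive (gx g)) (Derive (gy g)) sg th w); try lra.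
      + eapply polar_sub; [| |exact HP]; lra.
      + split; intros t Ht.
        * apply (C2_on_derive _ 0 (T g)); [exact Hx|lra].
        * apply (C2_on_derive _ 0 (T g)); [exact Hy|lra].
        * apply Hspeed; lra.
        * apply Heta; lra.
        * specialize (Hclose t ltac:(lra)).
          set (z := (gx gh t - gx g t) ^ 2 + (gy gh t - gy g t) ^ 2) in *.
          assert (0 <= z) by (apply Rplus_le_le_0_compat; apply pow2_ge_0).
          assert (Hz : sqrt z * sqrt z = z) by (apply sqrt_sqrt; lra).
          pose proof (sqrt_pos z). rewrite <- Hz. nra.
      + assert (V * (b - a) <= V * dl) by (apply Rmult_le_compat_l; lra). lra. }
  apply Hind; [lra|]. rewrite S_INR. destruct Hn as [_ Hn].
  apply Rlt_le, Rlt_div_l; assumption.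
Qed.

(** * Counting separated intervals *)

Lemma card_is_unique {X : Type} (A : X -> Prop) (n m : nat) :
  card_is A n -> card_is A m -> n = m.
Proof.
  intros [l [Hl [<- HA]]] [l' [Hl' [<- HA']]].
  apply Nat.le_antisymm; apply NoDup_incl_length; auto; intros x Hx;
    [apply HA', HA | apply HA, HA']; exact Hx.
Qed.

Lemma ecard_eq {X : Type} (A : X -> Prop) (n : nat) : card_is A n -> ecard A = Some n.
Proof.
  intros H. unfold ecard. destruct (excluded_middle_informative _) as [E|E].
  - f_equal. apply (card_is_unique A); [|exact H].
    exact (proj2_sig (constructive_indefinite_description _ E)).
  - exfalso. apply E. now exists n.
Qed.

(** Pigeonhole, by removing the element that carries the last label. Labels form a relation, so none
    has to be chosen. *)
Lemma finite_of_labels {X : Type} (N : nat) (A : X -> Prop) (F : X -> nat -> Prop) :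
  (forall x, A x -> exists n, (n < N)%nat /\ F x n) ->
  (forall x y n, A x -> A y -> F x n -> F y n -> x = y) ->
  exists m, (m <= N)%nat /\ card_is A m.
Proof.
  revert A. induction N as [|N IH]; intros A HF Hinj.
  - exists 0%nat. split; [lia|]. exists nil. repeat split; [constructor| |intros []].
    intros Hx. destruct (HF x Hx) as [n [Hn _]]. lia.
  - destruct (classic (exists x, A x /\ F x N)) as [[x [Ax Fx]]|Hno].
    + destruct (IH (fun y => A y /\ y <> x)) as [m [Hm [l [Hl [<- Hin]]]]].
      * intros y [Ay Hy]. destruct (HF y Ay) as [n [Hn Fy]]. exists n. split; [|exact Fy].
        destruct (Nat.eq_dec n N) as [->|]; [|lia].
        exfalso. apply Hy. now apply (Hinj y x N).
      * intros y z n [Ay _] [Az _]. now apply Hinj.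
      * exists (S (length l)). split; [lia|]. exists (x :: l).
        split; [|split; [reflexivity|intros y; split]].
        -- constructor; [|exact Hl]. intros Hx. apply Hin in Hx. now destruct Hx.
        -- intros Ay. destruct (classic (y = x)) as [->|Hy]; [now left|].
           right. apply Hin. now split.
        -- intros [<-|Hy]; [exact Ax|]. now apply Hin in Hy.
    + destruct (IH A) as [m [Hm Hc]]; [|exact Hinj|exists m; split; [lia|exact Hc]].
      intros x Ax. destruct (HF x Ax) as [n [Hn Fx]]. exists n. split; [|exact Fx].
      destruct (Nat.eq_dec n N) as [->|]; [|lia]. exfalso. apply Hno. now exists x.
Qed.

(** Label an element by the integer part of [lam / gap] at a representative: equal labels mean a
    difference below [gap]. The relation [rep] also covers elements that are classes of
    intervals. *)
Lemma finite_of_separation {X I : Type} (A : X -> Prop) (rep : X -> I -> Prop)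
  (lam : I -> R) (gap L : R) (N : nat) :
  0 < gap -> L < INR N * gap ->
  (forall x, A x -> exists i, rep x i /\ 0 <= lam i <= L) ->
  (forall x y i j, A x -> A y -> rep x i -> rep y j ->
     lam i <= lam j -> lam j - lam i < gap -> x = y) ->
  exists m, (m <= N)%nat /\ card_is A m.
Proof.
  intros Hg HL Hrep Hsep.
  apply (finite_of_labels N A
    (fun x n => exists i, rep x i /\ INR n <= lam i / gap < INR n + 1)).
  - intros x Ax. destruct (Hrep x Ax) as [i [Hi Hl]].
    destruct (nfloor_ex (lam i / gap)) as [n Hn].
    { apply Rle_div_r; lra. }
    exists n. split; [|now exists i].
    apply INR_lt. apply Rle_lt_trans with (lam i / gap); [lra|].
    apply Rlt_div_l; lra.
  - intros x y n Ax Ay [i [Hi [Hi1 Hi2]]] [j [Hj [Hj1 Hj2]]].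
    apply Rle_div_r in Hi1, Hj1; try lra. apply Rlt_div_l in Hi2, Hj2; try lra.
    destruct (Rle_lt_dec (lam i) (lam j)).
    + apply (Hsep x y i j); auto; lra.
    + symmetry. apply (Hsep y x j i); auto; lra.
Qed.

(** The union of two overlapping intervals again has its trace in [K], and maximality equates both
    with it. *)
Lemma A_set_overlap (g : traj) (K : point -> Prop) (i j : R * R) :
  A_set g K i -> A_set g K j -> fst i <= snd j -> fst j <= snd i -> i = j.
Proof.
  intros [I1 [I2 [I3 [I4 I5]]]] [J1 [J2 [J3 [J4 J5]]]] H1 H2.
  set (a := Rmin (fst i) (fst j)). set (b := Rmax (snd i) (snd j)).
  assert (Ha : 0 <= a) by (apply Rmin_glb; lra).
  assert (Hb : b <= T g) by (apply Rmax_lub; lra).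
  pose proof (Rmin_l (fst i) (fst j)). pose proof (Rmin_r (fst i) (fst j)).
  pose proof (Rmax_l (snd i) (snd j)). pose proof (Rmax_r (snd i) (snd j)).
  assert (Hin : inside g K a b).
  { intros t [Hta Htb]. unfold a, Rmin in Hta. unfold b, Rmax in Htb.
    destruct (Rle_lt_dec (fst i) t), (Rle_lt_dec t (snd i)); try (apply I4; lra);
    apply J4; destruct (Rle_dec (fst i) (fst j)), (Rle_dec (snd i) (snd j)); lra. }
  destruct (I5 a b) as [E1 E2]; auto. destruct (J5 a b) as [E3 E4]; auto.
  apply injective_projections; congruence.
Qed.

(** Without an exit in between, the hull of both intervals would contradict the maximality of
    [i]. *)
Lemma A_set_gap (g : traj) (K : point -> Prop) (i j : R * R) :
  A_set g K i -> A_set g K j -> i <> j -> fst i <= fst j ->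
  snd i < fst j /\ exists t, snd i < t < fst j /\ ~ K (gx g t, gy g t).
Proof.
  intros Hi Hj Hne Hle.
  assert (Hlt : snd i < fst j).
  { apply Rnot_le_lt. intros H. apply Hne. apply (A_set_overlap g K); auto.
    destruct Hj as [_ [J2 _]]. lra. }
  split; [exact Hlt|]. apply NNPP. intros Hno.
  destruct Hi as [I1 [I2 [I3 [I4 I5]]]], Hj as [J1 [J2 [J3 [J4 J5]]]].
  destruct (I5 (fst i) (snd j)) as [_ E]; try lra.
  intros t Ht. destruct (Rle_lt_dec t (snd i)); [apply I4; lra|].
  destruct (Rle_lt_dec (fst j) t); [apply J4; lra|].
  apply NNPP. intros HK. apply Hno. exists t. split; [lra|exact HK].
Qed.

(** Both ends are pushed outwards as far as [K] allows; closedness of [K] along the curve makes the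
    extreme positions attained. *)
Lemma maximal_extension (g : traj) (K : point -> Prop) (a b : R) :
  0 <= a <= b -> b <= T g ->
  (forall t, 0 <= t <= T g -> ~ K (gx g t, gy g t) ->
     locally_false (fun s => K (gx g s, gy g s)) t) ->
  inside g K a b -> exists k, A_set g K k /\ fst k <= a /\ b <= snd k.
Proof.
  intros Hab HbT Hcl Hin.
  destruct (closed_has_last (fun t => inside g K b t) b (T g)) as [b' [Hb' [Hinb Hlast]]].
  { lra. }
  { intros t Ht. apply Hin. lra. }
  { intros t Ht Hn. apply not_all_ex_not in Hn as [u Hu].
    apply imply_to_and in Hu as [Hu HK].
    destruct (Req_dec u t) as [->|Hne].
    - destruct (Hcl t) as [e [He Hf]]; [lra|exact HK|]. exists e. split; [exact He|].
      intros s Hs Hi. destruct (Rle_lt_dec t s); [apply HK, Hi; lra|].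
      destruct (Rle_lt_dec b s).
      + apply (Hf s Hs), Hi; lra.
      (* Here [s < b], so [inside g K b s] is vacuous; if [b < t], the point [b] lies between [s]
         and [t] and gives the contradiction. *)
      + destruct (Rle_lt_dec t b); [apply HK, Hin; lra|].
        apply (Hf b); [apply Rabs_def2 in Hs; apply Rabs_def1; lra|apply Hin; lra].
    - exists (t - u). split; [lra|]. intros s Hs Hi. apply Rabs_def2 in Hs.
      apply HK, Hi. lra. }
  destruct (closed_has_first (fun t => inside g K t a) 0 a) as [a' [Ha' [Hina Hfirst]]].
  { lra. }
  { intros t Ht. apply Hin. lra. }
  { intros t Ht Hn. apply not_all_ex_not in Hn as [u Hu].
    apply imply_to_and in Hu as [Hu HK].
    destruct (Req_dec u t) as [->|Hne].
    - destruct (Hcl t) as [e [He Hf]]; [lra|exact HK|]. exists e. split; [exact He|].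
      intros s Hs Hi. destruct (Rle_lt_dec s t); [apply HK, Hi; lra|].
      destruct (Rle_lt_dec s a).
      + apply (Hf s Hs), Hi; lra.
      + destruct (Rle_lt_dec a t); [apply HK, Hin; lra|].
        apply (Hf a); [apply Rabs_def2 in Hs; apply Rabs_def1; lra|apply Hin; lra].
    - exists (u - t). split; [lra|]. intros s Hs Hi. apply Rabs_def2 in Hs.
      apply HK, Hi. lra. }
  exists (a', b'). split; [|simpl; lra]. unfold A_set; simpl.
  split; [lra|]. split; [lra|]. split; [lra|]. split.
  - intros t Ht. destruct (Rle_lt_dec t a); [apply Hina; lra|].
    destruct (Rle_lt_dec b t); [apply Hinb; lra|apply Hin; lra].
  - intros a0 b0 H0 Ha0 Hb0 HbT0 Hin0. split.
    + apply Rle_antisym; [assumption|]. apply Rnot_lt_le. intros Hlt.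
      apply (Hfirst a0); [lra|]. intros t Ht. apply Hin0. lra.
    + apply Rle_antisym; [|assumption]. apply Rnot_lt_le. intros Hlt.
      apply (Hlast b0); [lra|]. intros t Ht. apply Hin0. lra.
Qed.

(** The unit tangent has component cos (th - al) <= 1 along [(u, v)], so [len] grows at least as
    fast as this coordinate, and likewise for the opposite direction. *)
Lemma displacement_le_len rho hx hy sg th w len a b u v :
  u ^ 2 + v ^ 2 = 1 -> a <= b -> polar rho hx hy sg th w len a b ->
  Rabs (u * (hx b - hx a) + v * (hy b - hy a)) <= len b - len a.
Proof.
  intros Huv Hab HP.
  destruct (unit_vector_angle u v Huv) as [al [Eu Ev]].
  assert (Hs : forall s, s = 1 \/ s = -1 ->
    s * (u * (hx b - hx a) + v * (hy b - hy a)) <= len b - len a).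
  { intros s Hs.
    assert (Hle := derive_nonneg_le
      (fun t => len t - s * (u * hx t + v * hy t)) a b Hab).
    simpl in Hle. lapply Hle; [lra|]. intros t Ht.
    exists (sg t * (1 - s * cos (th t - al))). split.
    - pose proof (polar_x _ _ _ _ _ _ _ _ _ HP t Ht) as H1.
      pose proof (polar_y _ _ _ _ _ _ _ _ _ HP t Ht) as H2.
      pose proof (polar_len _ _ _ _ _ _ _ _ _ HP t Ht) as H3.
      auto_derive; [repeat split; eexists; eassumption|].
      rewrite (is_derive_unique (fun x : R => hx x) t _ H1),
        (is_derive_unique (fun x : R => hy x) t _ H2),
        (is_derive_unique (fun x : R => len x) t _ H3), cos_minus, Eu, Ev. ring.
    - pose proof (polar_speed _ _ _ _ _ _ _ _ _ HP t Ht).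
      pose proof (COS_bound (th t - al)).
      apply Rmult_le_pos; [lra|]. destruct Hs as [-> | ->]; lra. }
  apply Rabs_le. pose proof (Hs 1 (or_introl eq_refl)).
  pose proof (Hs (-1) (or_intror eq_refl)). lra.
Qed.

(* While [h] stays within [rho] of [(x1, x2)] its squared distance to that point is
   convex as a function of arc length, so it has no interior maximum. *)
Lemma excursion_reaches_rho rho hx hy sg th w len a b t x1 x2 r :
  0 < rho -> a < t < b -> polar rho hx hy sg th w len a b ->
  (hx a - x1) ^ 2 + (hy a - x2) ^ 2 <= r ^ 2 ->
  (hx b - x1) ^ 2 + (hy b - x2) ^ 2 <= r ^ 2 ->
  r ^ 2 < (hx t - x1) ^ 2 + (hy t - x2) ^ 2 ->
  exists s, a <= s <= b /\ rho ^ 2 <= (hx s - x1) ^ 2 + (hy s - x2) ^ 2.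
Proof.
  intros Hr Ht HP Ha Hb Hout. apply NNPP. intros Hno.
  assert (Hin : forall s, a <= s <= b -> (hx s - x1) ^ 2 + (hy s - x2) ^ 2 < rho ^ 2).
  { intros s Hs. apply Rnot_le_lt. intros H. apply Hno. now exists s. }
  (* Up to the positive factor 2 sg, [F] is the derivative of the squared distance; its strict
     growth is the convexity in arc length. *)
  set (F := tang hx hy (fun _ => x1) (fun _ => x2) th).
  assert (HF : forall s s', a <= s -> s < s' -> s' <= b -> F s < F s').
  { intros s s' Hs Hss Hs'. apply derive_pos_lt; [exact Hss|]. intros v Hv.
    eexists. split.
    - eapply is_derive_tang; [eapply polar_x | eapply polar_y
        | apply (@is_derive_const R_AbsRing) | apply (@is_derive_const R_AbsRing)
        | eapply polar_th]; eauto; lra.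
    - assert (Hvab : a <= v <= b) by lra.
      unfold zero; simpl.
      pose proof (sin2_cos2 (th v)) as E. unfold Rsqr in E.
      replace ((sg v * cos (th v) - 0) * cos (th v) + (sg v * sin (th v) - 0) * sin (th v))
        with (sg v * (sin (th v) * sin (th v) + cos (th v) * cos (th v))) by ring.
      rewrite E.
      specialize (Hin v Hvab).
      rewrite <- (tang_nrml_sqr hx hy (fun _ => x1) (fun _ => x2) th v) in Hin.
      apply Rabs_lt_of_sqr in Hin as [_ HN]; [|exact Hr].
      pose proof (polar_curv _ _ _ _ _ _ _ _ _ HP v Hvab).
      pose proof (polar_speed _ _ _ _ _ _ _ _ _ HP v Hvab).
      set (N := nrml hx hy (fun _ => x1) (fun _ => x2) th v) in *.
      assert (HNr : Rabs N < rho) by (apply Rabs_def1; lra).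
      assert (Rabs (w v * N) < sg v).
      { rewrite Rabs_mult. pose proof (Rabs_pos (w v)). pose proof (Rabs_pos N).
        destruct (Req_dec (Rabs (w v)) 0) as [->|]; [lra|]. nra. }
      apply Rabs_def2 in H1. lra. }
  set (D := fun s => (hx s - x1) ^ 2 + (hy s - x2) ^ 2).
  assert (HD : forall s, a <= s <= b -> derivable_pt_lim D s (2 * sg s * F s)).
  { intros s Hs. apply is_derive_Reals.
    pose proof (polar_x _ _ _ _ _ _ _ _ _ HP s Hs) as H1.
    pose proof (polar_y _ _ _ _ _ _ _ _ _ HP s Hs) as H2.
    unfold D, F, tang. auto_derive; [repeat split; eexists; eassumption|].
    rewrite (is_derive_unique (fun x : R => hx x) s _ H1),
      (is_derive_unique (fun x : R => hy x) s _ H2). ring. }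
  (* A larger distance at [t] than at both ends gives [F > 0] somewhere before [t] and [F < 0]
     somewhere after it. *)
  destruct (MVT_cor2 D (fun s => 2 * sg s * F s) a t) as [s [Es Hs]]; [lra| |].
  { intros; apply HD; lra. }
  destruct (MVT_cor2 D (fun s => 2 * sg s * F s) t b) as [s' [Es' Hs']]; [lra| |].
  { intros; apply HD; lra. }
  assert (HDat : 0 < D t - D a) by (unfold D; lra).
  assert (HDtb : D b - D t < 0) by (unfold D; lra).
  pose proof (polar_speed _ _ _ _ _ _ _ _ _ HP s ltac:(lra)).
  pose proof (polar_speed _ _ _ _ _ _ _ _ _ HP s' ltac:(lra)).
  assert (0 < F s).
  { apply Rnot_le_lt. intros Hle. rewrite Es in HDat.
    assert (0 <= sg s * (t - s) * (t - a)) by (repeat apply Rmult_le_pos; lra).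
    assert (0 <= sg s * (- F s) * (t - a)) by (repeat apply Rmult_le_pos; lra). lra. }
  assert (F s' < 0).
  { apply Rnot_le_lt. intros Hle. rewrite Es' in HDtb.
    assert (0 <= sg s' * F s' * (b - t)) by (repeat apply Rmult_le_pos; lra). lra. }
  specialize (HF s s'). lra.
Qed.

(** * Stability and instability *)

Lemma ecard_Some {X : Type} (A : X -> Prop) (n : nat) : ecard A = Some n -> card_is A n.
Proof.
  unfold ecard. destruct (excluded_middle_informative _) as [E|E]; [|discriminate].
  intros [= <-]. exact (proj2_sig (constructive_indefinite_description _ E)).
Qed.

(** A trajectory is a small perturbation of itself, so a bound on all perturbed counts also bounds
    the original count, hence the difference. *)
Lemma stable_of_uniform_bound (kmax : R) (C : count_fun) : 0 < kmax ->
  (forall g, is_traj kmax g -> exists N, forall gh, small_perturbation kmax g gh ->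
     forall x, exists m, (m <= N)%nat /\ C gh x = Some m) ->
  stable kmax C.
Proof.
  intros Hk HC g Hg. destruct (HC g Hg) as [N HN]. exists N. intros gh Hgh x.
  destruct (HN gh Hgh x) as [m [Hm ->]].
  destruct (HN g) with (x := x) as [n [Hn ->]].
  - split; [exact Hg|]. split; [reflexivity|]. exists 0.
    split; [apply Rinv_0_lt_compat, Hk|]. intros t _.
    rewrite !Rminus_diag, pow_i, Rplus_0_l, sqrt_0 by lia. lra.
  - simpl. lia.
Qed.

(** Between two visits the curve reaches distance [rho] from the centre, and the way there and back
    has length at least 2 (rho - r). The arc lengths at which visits start are thus separated. *)
Lemma disk_stable (kmax r : R) : 0 < kmax -> 0 < r -> r < / kmax -> stable kmax (C_B r).
Proof.
  intros Hk Hr Hrk. apply stable_of_uniform_bound; [exact Hk|]. intros g Hg.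
  destruct (perturbation_length_bound kmax g Hk Hg) as [Lmax HL].
  set (rho := / kmax) in *. assert (Hgap : 0 < 2 * (rho - r)) by lra.
  destruct (INR_archimed (2 * (rho - r)) Lmax Hgap) as [N HN].
  exists N. intros gh Hgh x. destruct (HL gh Hgh) as [sg [th [w [len [HP [Hl0 HlT]]]]]].
  assert (Hmono : forall a b, 0 <= a -> a <= b -> b <= T gh -> len a <= len b).
  { intros. eapply len_mono; [|eapply polar_sub; [| |exact HP]]; lra. }
  assert (Hsep : forall i j, A_set gh (disk x r) i -> A_set gh (disk x r) j ->
    i <> j -> fst i <= fst j -> 2 * (rho - r) <= len (fst j) - len (fst i)).
  { intros i j Hi Hj Hne Hle.
    destruct (A_set_gap gh (disk x r) i j Hi Hj Hne Hle) as [Hlt [t [Ht Hout]]].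
    destruct Hi as [I1 [I2 [I3 [I4 _]]]], Hj as [J1 [J2 [J3 [J4 _]]]].
    specialize (I4 (snd i) ltac:(lra)). specialize (J4 (fst j) ltac:(lra)).
    unfold disk in I4, J4, Hout. simpl fst in *; simpl snd in *.
    apply Rnot_le_lt in Hout.
    destruct (excursion_reaches_rho rho (gx gh) (gy gh) sg th w len (snd i) (fst j) t
      (fst x) (snd x) r) as [s [Hs Hrs]]; auto; try lra.
    { eapply polar_sub; [| |exact HP]; lra. }
    set (px := gx gh s - fst x) in *. set (py := gy gh s - snd x) in *.
    (* Project on the unit vector from the centre to the point at [s]: the component is [D >= rho]
       there and at most [r] at both visits. *)
    set (D := sqrt (px ^ 2 + py ^ 2)).
    assert (HDD : D * D = px ^ 2 + py ^ 2) by (apply sqrt_sqrt; nra).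
    assert (HD0 : 0 <= D) by apply sqrt_pos.
    assert (HD : rho <= D) by nra.
    assert (Hunit : (px / D) ^ 2 + (py / D) ^ 2 = 1).
    { replace ((px / D) ^ 2 + (py / D) ^ 2) with ((px ^ 2 + py ^ 2) / (D * D))
        by (field; lra). rewrite <- HDD. field. lra. }
    assert (Hdot : px / D * px + py / D * py = D).
    { replace (px / D * px + py / D * py) with ((px ^ 2 + py ^ 2) / D) by (field; lra).
      rewrite <- HDD. field. lra. }
    assert (Hnear : forall qx qy, qx ^ 2 + qy ^ 2 <= r ^ 2 ->
      px / D * qx + py / D * qy <= r).
    { intros qx qy Hq. set (u := px / D) in *. set (v := py / D) in *.
      assert ((u * qx + v * qy) ^ 2 + (u * qy - v * qx) ^ 2 = qx ^ 2 + qy ^ 2).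
      { replace (qx ^ 2 + qy ^ 2) with ((u ^ 2 + v ^ 2) * (qx ^ 2 + qy ^ 2))
          by (rewrite Hunit; ring). ring. }
      pose proof (pow2_ge_0 (u * qy - v * qx)). nra. }
    pose proof (Hnear _ _ I4) as N1. pose proof (Hnear _ _ J4) as N2.
    pose proof (displacement_le_len rho (gx gh) (gy gh) sg th w len (snd i) s _ _ Hunit
      ltac:(lra) ltac:(eapply polar_sub; [| |exact HP]; lra)) as L1.
    pose proof (displacement_le_len rho (gx gh) (gy gh) sg th w len s (fst j) _ _ Hunit
      ltac:(lra) ltac:(eapply polar_sub; [| |exact HP]; lra)) as L2.
    apply Rabs_le_between in L1, L2.
    pose proof (Hmono (fst i) (snd i)).
    unfold px, py in *. lra. }
  destruct (finite_of_separation (A_set gh (disk x r)) (fun i j => i = j)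
    (fun i => len (fst i)) (2 * (rho - r)) Lmax N Hgap HN) as [m [Hm Hc]].
  - intros i Hi. exists i. split; [reflexivity|]. destruct Hi as [I1 [I2 [I3 _]]].
    pose proof (Hmono 0 (fst i)). pose proof (Hmono (fst i) (T gh)). lra.
  - intros i j ? ? Hi Hj <- <- Hle Hlt. apply NNPP. intros Hne.
    destruct (Rle_lt_dec (fst i) (fst j)).
    + specialize (Hsep i j Hi Hj Hne). lra.
    + specialize (Hsep j i Hj Hi (not_eq_sym Hne)). lra.
  - exists m. split; [exact Hm|]. apply ecard_eq, Hc.
Qed.

(** * Stability of the robust square count *)

Lemma square_iff (c : point) (r px py : R) :
  square c r (px, py) <-> Rabs (px - fst c) <= r /\ Rabs (py - snd c) <= r.
Proof.
  unfold square. simpl. split.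
  - intros H. split; eapply Rle_trans; [apply Rmax_l|exact H|apply Rmax_r|exact H].
  - intros [H1 H2]. now apply Rmax_lub.
Qed.

Lemma square_closed_along (g : traj) (c : point) (r t : R) :
  continuity_pt (gx g) t -> continuity_pt (gy g) t ->
  ~ square c r (gx g t, gy g t) ->
  locally_false (fun s => square c r (gx g s, gy g s)) t.
Proof.
  intros Cx Cy Hn. rewrite square_iff in Hn.
  assert (Hc : forall f z, continuity_pt f t -> continuity_pt (fun s => Rabs (f s - z)) t).
  { intros f z Hf. apply (continuity_pt_comp (fun s => f s - z) Rabs).
    - apply (continuity_pt_minus f (fun _ => z)); [exact Hf|].
      apply continuity_pt_const. now intros ? ?.
    - apply Rcontinuity_abs. }
  apply not_and_or in Hn as [Hn|Hn];
    [apply (locally_false_le (fun s => Rabs (gx g s - fst c))) in Hn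
    |apply (locally_false_le (fun s => Rabs (gy g s - snd c))) in Hn]; auto;
    destruct Hn as [e [He Hf]]; exists e; (split; [exact He|]);
    intros s Hs Hsq; apply square_iff in Hsq; apply (Hf s Hs), Hsq.
Qed.

Lemma robust_equiv_sym g x r2 i j : robust_equiv g x r2 i j -> robust_equiv g x r2 j i.
Proof. intros [k Hk]. exists k. tauto. Qed.

(** Both witnesses contain [j], so as maximal intervals they coincide. *)
Lemma robust_equiv_trans g x r2 i j l : fst j <= snd j ->
  robust_equiv g x r2 i j -> robust_equiv g x r2 j l -> robust_equiv g x r2 i l.
Proof.
  intros Hj [k [Hk [K1 [K2 [K3 K4]]]]] [k' [Hk' [L1 [L2 [L3 L4]]]]].
  assert (k = k') as <- by (apply (A_set_overlap g (square x r2)); auto; lra).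
  exists k. tauto.
Qed.

(** Inequivalent visits are separated by an exit from the larger square, which moves one coordinate
    by more than [r2 - r1] out and again back. *)
Lemma robust_square_stable (kmax r1 r2 : R) : 0 < kmax -> 0 < r1 -> r1 < r2 ->
  stable kmax (C_SS r1 r2).
Proof.
  intros Hk Hr1 Hr12. apply stable_of_uniform_bound; [exact Hk|]. intros g Hg.
  destruct (perturbation_length_bound kmax g Hk Hg) as [Lmax HL].
  assert (Hgap : 0 < 2 * (r2 - r1)) by lra.
  destruct (INR_archimed (2 * (r2 - r1)) Lmax Hgap) as [N HN].
  exists N. intros gh Hgh x. destruct (HL gh Hgh) as [sg [th [w [len [HP [Hl0 HlT]]]]]].
  assert (Hmono : forall a b, 0 <= a -> a <= b -> b <= T gh -> len a <= len b).
  { intros. eapply len_mono; [|eapply polar_sub; [| |exact HP]]; lra. }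
  assert (Hsep : forall i j, A_set gh (square x r1) i -> A_set gh (square x r1) j ->
    ~ robust_equiv gh x r2 i j -> fst i <= fst j ->
    2 * (r2 - r1) <= len (fst j) - len (fst i)).
  { intros i j Hi Hj Hne Hle.
    assert (Hsub : forall px py, square x r1 (px, py) -> square x r2 (px, py)).
    { intros px py H. apply square_iff in H. apply square_iff. lra. }
    destruct Hi as [I1 [I2 [I3 [I4 _]]]], Hj as [J1 [J2 [J3 [J4 _]]]].
    assert (exists t, snd i < t < fst j /\ ~ square x r2 (gx gh t, gy gh t))
      as [t [Ht Hout]].
    (* Otherwise one trace inside the larger square covers both intervals, and its maximal extension
       makes them equivalent. *)
    { apply NNPP. intros Hno. apply Hne.
      destruct (maximal_extension gh (square x r2) (fst i) (Rmax (snd i) (snd j)))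
        as [k [HkA [Hk1 Hk2]]].
      - pose proof (Rmax_l (snd i) (snd j)). lra.
      - apply Rmax_lub; lra.
      - intros t Ht. apply square_closed_along;
          [eapply is_derive_continuity_pt, polar_x | eapply is_derive_continuity_pt, polar_y];
          eauto.
      - intros t Ht. destruct (Rle_lt_dec t (snd i)); [apply Hsub, I4; lra|].
        destruct (Rle_lt_dec (fst j) t).
        + apply Hsub, J4. split; [lra|]. destruct Ht as [_ Ht].
          unfold Rmax in Ht. destruct (Rle_dec (snd i) (snd j)); lra.
        + apply NNPP. intros HK. apply Hno. exists t. split; [lra|exact HK].
      - pose proof (Rmax_l (snd i) (snd j)). pose proof (Rmax_r (snd i) (snd j)).
        exists k. split; [exact HkA|lra]. }
    specialize (I4 (snd i) ltac:(lra)). specialize (J4 (fst j) ltac:(lra)).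
    rewrite square_iff in I4, J4, Hout.
    destruct I4 as [I4x I4y], J4 as [J4x J4y].
    pose proof (Hmono (fst i) (snd i)).
    assert (Hdisp : forall u v, u ^ 2 + v ^ 2 = 1 ->
      Rabs (u * (gx gh t - gx gh (snd i)) + v * (gy gh t - gy gh (snd i))) <= len t - len (snd i) /\
      Rabs (u * (gx gh (fst j) - gx gh t) + v * (gy gh (fst j) - gy gh t)) <= len (fst j) - len t).
    { intros u v Huv. split; eapply displacement_le_len; eauto; try lra;
        (eapply polar_sub; [| |exact HP]; lra). }
    apply Rabs_le_between in I4x, I4y, J4x, J4y.
    apply not_and_or in Hout as [Hout|Hout]; apply Rnot_le_lt in Hout;
      [destruct (Hdisp 1 0) as [D1 D2]|destruct (Hdisp 0 1) as [D1 D2]]; try ring;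
      apply Rabs_le_between in D1, D2; unfold Rabs in Hout;
      destruct (Rcase_abs _) in Hout; lra. }
  destruct (finite_of_separation (robust_classes gh x r1 r2)
    (fun P i => A_set gh (square x r1) i /\
       P = (fun j => A_set gh (square x r1) j /\ robust_equiv gh x r2 i j))
    (fun i => len (fst i)) (2 * (r2 - r1)) Lmax N Hgap HN) as [m [Hm Hc]].
  - intros P [i [Hi HPi]]. exists i. split; [now split|]. destruct Hi as [I1 [I2 [I3 _]]].
    pose proof (Hmono 0 (fst i)). pose proof (Hmono (fst i) (T gh)). lra.
  - intros P Q i j _ _ [Hi ->] [Hj ->] Hle Hlt.
    assert (Hij : robust_equiv gh x r2 i j).
    { apply NNPP. intros Hne. destruct (Rle_lt_dec (fst i) (fst j)).
      - specialize (Hsep i j Hi Hj Hne). lra.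
      - specialize (Hsep j i Hj Hi). lapply Hsep; [lra|].
        intros H. apply Hne, robust_equiv_sym, H. }
    assert (fst i <= snd i) by apply Hi. assert (fst j <= snd j) by apply Hj.
    (* Classes are predicates; equivalent representatives give the same one by symmetry and
       transitivity. *)
    apply functional_extensionality. intros l. apply propositional_extensionality.
    split; intros [Hl E]; (split; [exact Hl|]).
    + apply (robust_equiv_trans gh x r2 j i l); auto using robust_equiv_sym.
    + apply (robust_equiv_trans gh x r2 i j l); auto.
  - exists m. split; [exact Hm|]. apply ecard_eq, Hc.
Qed.

(** * Instability of the square count *)

Definition graph_traj (len : R) (f : R -> R) : traj := mkTraj len (fun t => t) f.

(** The curvature of a graph is |f''| / (1 + f'^2)^(3/2), hence at most |f''|. *)
Lemma graph_is_traj (kmax len : R) (f df ddf : R -> R) : 0 < len ->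
  (forall t, is_derive f t (df t)) -> (forall t, is_derive df t (ddf t)) ->
  (forall t, continuous ddf t) -> (forall t, Rabs (ddf t) <= kmax) ->
  is_traj kmax (graph_traj len f).
Proof.
  intros Hlen Hf Hdf Hddf Hk.
  assert (E1 : Derive f = df)
    by (apply functional_extensionality; intros t; apply is_derive_unique, Hf).
  assert (E2 : Derive df = ddf)
    by (apply functional_extensionality; intros t; apply is_derive_unique, Hdf).
  assert (E3 : Derive (fun t : R => t) = fun _ => 1)
    by (apply functional_extensionality; intros t; apply Derive_id).
  assert (E4 : Derive (fun _ : R => 1) = fun _ => 0)
    by (apply functional_extensionality; intros t; apply Derive_const).
  split; [exact Hlen|]. split; [|split; [|split]]; simpl.
  - exists 1. split; [lra|]. intros t _. rewrite E3, E4.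
    split; [apply ex_derive_id|]. split; [apply ex_derive_const|].
    apply continuous_const.
  - exists 1. split; [lra|]. intros t _. rewrite E1, E2.
    split; [now exists (df t)|]. split; [now exists (ddf t)|]. apply Hddf.
  - intros t _. unfold speed2; simpl. rewrite E1, E3. nra.
  - intros t _. unfold curvature, speed2; simpl gx; simpl gy. rewrite E1, E2, E3, E4.
    replace (1 * ddf t - df t * 0) with (ddf t) by ring.
    assert (H1 : 1 <= 1 ^ 2 + df t ^ 2) by nra.
    assert (H2 : 1 <= sqrt (1 ^ 2 + df t ^ 2))
      by (rewrite <- sqrt_1 at 1; apply sqrt_le_1_alt, H1).
    set (z := 1 ^ 2 + df t ^ 2) in *. specialize (Hk t).
    apply Rle_div_l; [nra|]. pose proof (Rabs_pos (ddf t)).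
    assert (1 <= z * sqrt z) by nra. nra.
Qed.

(** The unperturbed curve is a horizontal segment above the square, with count 0; any bound [M] is
    beaten by a perturbation with at least [M + 1] isolated contacts. *)
Lemma square_unstable (kmax r : R) : 0 < kmax -> 0 < r -> ~ stable kmax (C_S r).
Proof.
  intros Hk Hr Hst. pose proof PI_RGT_0 as Hpi.
  assert (HIk : 0 < / kmax) by (apply Rinv_0_lt_compat, Hk).
  set (g := graph_traj (2 * r) (fun _ => / kmax / 2)).
  assert (Hg : is_traj kmax g).
  { apply graph_is_traj with (df := fun _ => 0) (ddf := fun _ => 0); [lra| | | |].
    - intros t. apply (@is_derive_const R_AbsRing).
    - intros t. apply (@is_derive_const R_AbsRing).
    - intros t. apply continuous_const.
    - intros t. rewrite Rabs_R0. lra. }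
  destruct (Hst g Hg) as [M HM].
  set (n := INR (S M)). assert (Hn : 0 < n) by (apply lt_0_INR; lia).
  set (om := PI * n / r). assert (Hom : 0 < om) by (apply Rdiv_lt_0_compat; nra).
  (* The first entry keeps the height of the bumps within [/ kmax / 2], the second keeps their
     second derivative within [kmax]. *)
  set (A := Rmin (/ kmax / 4) (kmax / om ^ 2)).
  assert (Hom2 : 0 < om ^ 2) by nra.
  assert (HA0 : 0 < A) by (apply Rmin_pos; [lra|apply Rdiv_lt_0_compat; lra]).
  assert (HA1 : A <= / kmax / 4) by apply Rmin_l.
  assert (HA2 : A * om ^ 2 <= kmax) by (apply Rle_div_r; [lra|apply Rmin_r]).
  set (gh := graph_traj (2 * r) (fun t => A * (1 - cos (om * t)))).
  assert (Hgh : is_traj kmax gh).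
  { apply graph_is_traj with (df := fun t => A * om * sin (om * t))
      (ddf := fun t => A * om ^ 2 * cos (om * t)); [lra| | | |].
    - intros t. auto_derive; [exact I|ring].
    - intros t. auto_derive; [exact I|ring].
    - intros t. apply (ex_derive_continuous (fun t => A * om ^ 2 * cos (om * t))).
      auto_derive. exact I.
    - intros t. rewrite Rabs_mult, (Rabs_pos_eq (A * om ^ 2)) by nra.
      assert (Rabs (cos (om * t)) <= 1) by (apply Rabs_le; pose proof (COS_bound (om * t)); lra).
      pose proof (Rabs_pos (cos (om * t))). nra. }
  specialize (HM gh). lapply HM; [clear HM; intros HM|].
  2: { split; [exact Hgh|]. split; [reflexivity|]. exists (/ kmax / 2). split; [lra|].
    intros t _. simpl gx; simpl gy. pose proof (COS_bound (om * t)).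
    assert (0 <= A * (1 - cos (om * t)) <= / kmax / 2) by (split; nra).
    rewrite <- (sqrt_pow2 (/ kmax / 2)) at 2 by lra. apply sqrt_le_1_alt. nra. }
  (* The top edge of this square lies on the axis y = 0, and its width spans the whole time
     domain. *)
  specialize (HM (r, - r)). unfold C_S in HM.
  rewrite (ecard_eq (A_set g (square (r, - r) r)) 0) in HM.
  2: { exists nil. split; [constructor|]. split; [reflexivity|]. intros i. split; [|intros []].
    intros [I1 [I2 [I3 [I4 _]]]]. specialize (I4 (fst i) ltac:(lra)).
    apply square_iff in I4. simpl in I4. destruct I4 as [_ I4].
    apply Rabs_le_between in I4. lra. }
  destruct (ecard (A_set gh (square (r, - r) r))) as [m|] eqn:Em; [|exact HM].
  destruct HM as [HM _]. apply ecard_Some in Em as [l [Hl [<- HlA]]].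
  (* Contact times, where om * tk k = 2 pi k; the indices from 0 to [M] give [M + 1] degenerate
     maximal intervals. *)
  set (tk := fun k : nat => 2 * r * INR k / n).
  assert (Hlen : (length (map (fun k => (tk k, tk k)) (seq 0 (S M))) <= length l)%nat).
  { apply NoDup_incl_length.
    - apply FinFun.Injective_map_NoDup; [|apply seq_NoDup].
      intros k k' [= E _]. apply INR_eq. unfold tk in E.
      apply (f_equal (fun z => z * n / (2 * r))) in E. field_simplify in E; lra.
    - intros i Hi. apply in_map_iff in Hi as [k [<- Hk']]. apply in_seq in Hk'.
      apply HlA. assert (Hkn : INR k <= n) by (apply le_INR; lia).
      pose proof (pos_INR k) as Hk0.
      assert (Etk : tk k * n = 2 * r * INR k) by (unfold tk; field; lra).
      assert (Hcos : cos (om * tk k) = 1).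
      { replace (om * tk k) with (0 + 2 * INR k * PI) by (unfold om, tk; field; lra).
        rewrite cos_period. apply cos_0. }
      assert (Hlow : forall t, square (r, - r) r (gx gh t, gy gh t) -> cos (om * t) = 1).
      { intros t Ht. apply square_iff in Ht. simpl in Ht. destruct Ht as [_ Ht].
        apply Rabs_le_between in Ht. pose proof (COS_bound (om * t)). nra. }
      (* Contacts are 2 pi / om apart, so no other one occurs within pi / om of [tk k]. *)
      assert (Hiso : forall t, 0 < Rabs (t - tk k) * om <= PI -> cos (om * t) <> 1).
      { intros t Ht Hc1. replace (om * t) with (om * tk k + om * (t - tk k)) in Hc1 by ring.
        assert (Hsin : sin (om * tk k) = 0).
        { pose proof (sin2_cos2 (om * tk k)) as E. rewrite Hcos in E. unfold Rsqr in E. nra. }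
        rewrite cos_plus, Hcos, Hsin in Hc1.
        assert (Hlt : cos (Rabs (t - tk k) * om) < cos 0) by (apply cos_decreasing_1; lra).
        rewrite cos_0 in Hlt.
        assert (cos (Rabs (t - tk k) * om) = cos (om * (t - tk k))); [|lra].
        unfold Rabs. destruct (Rcase_abs _).
        - rewrite <- cos_neg. f_equal. ring.
        - f_equal. ring. }
      assert (Hpo : 0 < PI / om) by (apply Rdiv_lt_0_compat; lra).
      assert (Hpom : PI / om * om = PI) by (field; lra).
      assert (Htk : 0 <= tk k <= 2 * r) by (split; nra).
      split; [simpl; lra|]. split; [simpl; lra|]. split; [simpl; lra|]. split.
      + intros t Ht. simpl fst in Ht; simpl snd in Ht. replace t with (tk k) by lra.
        apply square_iff. simpl. rewrite Hcos. split; apply Rabs_le; lra.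
      + simpl fst; simpl snd. intros a b Ha Ha' Hb Hb' Hin. split.
        * apply Rle_antisym; [exact Ha'|]. apply Rnot_lt_le. intros Hlt.
          (* A time of the larger interval close enough to [tk k] for [Hiso] to exclude a
             contact. *)
          set (t := Rmax a (tk k - PI / om)).
          assert (Ht : a <= t /\ tk k - PI / om <= t /\ t < tk k)
            by (unfold t, Rmax; destruct (Rle_dec a (tk k - PI / om)); lra).
          apply (Hiso t); [rewrite Rabs_left by lra; split; nra|].
          apply Hlow, Hin. lra.
        * apply Rle_antisym; [|exact Hb]. apply Rnot_lt_le. intros Hlt.
          set (t := Rmin b (tk k + PI / om)).
          assert (Ht : t <= b /\ t <= tk k + PI / om /\ tk k < t)
            by (unfold t, Rmin; destruct (Rle_dec b (tk k + PI / om)); lra).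
          apply (Hiso t); [rewrite Rabs_pos_eq by lra; split; nra|].
          apply Hlow, Hin. lra. }
  rewrite length_map, length_seq in Hlen. lia.
Qed.

Theorem theorem2 (kmax : R) (hk : 0 < kmax) :
  (forall r, 0 < r -> ~ stable kmax (C_S r)) /\
  (forall r, 0 < r -> r < / kmax -> stable kmax (C_B r)) /\
  (forall r1 r2, 0 < r1 -> r1 < r2 -> r2 < / kmax -> stable kmax (C_SS r1 r2)).
Proof.
  split; [|split].
  - intros r Hr. now apply square_unstable.
  - intros r Hr Hrk. now apply disk_stable.
  - intros r1 r2 Hr1 Hr12 _. now apply robust_square_stable.
Qed.
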